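(* Let $\mathcal{A}$ be a semi-abelian category with enough (regular) projectives. Then there exists a model category structure on the category $\mathcal{S}\mathcal{A}$ of simplicial objects in $\mathcal{A}$ in which the weak equivalences are the homology isomorphisms and the fibrations are the Kan fibrations.
   Context: A semi-abelian category is a category that is pointed (has a zero object), Barr exact (regular, i.e. finitely complete with coequalizers of kernel pairs and pullback-stable regular epimorphisms, and such that every internal equivalence relation is a kernel pair), Bourn protomodular (in this pointed regular context: the Short Five Lemma holds for regular epimorphisms and their kernels), and has binary coproducts. Such a category is finitely cocomplete. An object $P$ is (regular) projective if $\mathrm{Hom}(P,\cdot)$ sends regular epimorphisms to surjections; enough projectives means that every object is the codomain of a regular epimorphism with projective domain. ''Model category'' is meant in Quillen's sense of a closed model category (finite limits and colimits; factorizations not required to be functorial); the cofibrations are the morphisms with the left lifting property with respect to all morphisms that are both fibrations and weak equivalences. Homology. $K[f]$ denotes the kernel object of $f$; $[n]=\{0,\dots,n\}$. A simplicial object $A$ has faces $\partial_i\colon A_n\to A_{n-1}$, $i\in[n]$. Its Moore complex $N(A)$ has $N_0A=A_0$, $N_nA=\bigcap_{i=0}^{n-1}K[\partial_i\colon A_n\to A_{n-1}]$ for $n\geq1$, $N_nA=0$ for $n<0$, and differential $d_n\colon N_nA\to N_{n-1}A$, $n\ge1$, induced by the restriction of $\partial_n$. For $n\in\mathbb{N}$, $H_nA$ is the cokernel of the factorization $d'_{n+1}\colon N_{n+1}A\to K[d_n]$ of $d_{n+1}$ (where $K[d_0]=A_0$). A homology isomorphism is a morphism $f$ in $\mathcal{S}\mathcal{A}$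 such that $H_nf$ is an isomorphism for every $n\in\mathbb{N}$. Kan fibrations. For $n\geq 1$ and $k\in[n]$, a family $x=(x_i\colon X\to A_{n-1})_{i\in[n],\,i\neq k}$ is an $(n,k)$-horn of $A$ if $\partial_i\circ x_j=\partial_{j-1}\circ x_i$ for all $i<j$ with $i,j\neq k$. A map $f\colon A\to B$ of simplicial objects is a Kan fibration if, for every $(n,k)$-horn $x$ of $A$ with domain $X$ and every $b\colon X\to B_n$ with $\partial_i\circ b=f_{n-1}\circ x_i$ for all $i\neq k$, there are a regular epimorphism $p\colon Y\to X$ and a map $a\colon Y\to A_n$ such that $f_n\circ a=b\circ p$ and $\partial_i\circ a=x_i\circ p$ for all $i\neq k$. *)

(* Defs.v *)
From mathcomp Require Import all_boot.
From mathcomp Require Import boolp classical_sets cardinality.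

Set Implicit Arguments.
Unset Strict Implicit.
Unset Printing Implicit Defensive.

Declare Scope cat_scope.
Delimit Scope cat_scope with cat.
Local Open Scope cat_scope.

(** * Categories, functors, natural transformations *)

Record category := Category {
  ob :> Type;
  hom : ob -> ob -> Type;
  idm : forall x, hom x x;
  compm : forall x y z, hom y z -> hom x y -> hom x z;
  comp1m : forall x y (f : hom x y), compm (idm y) f = f;
  compm1 : forall x y (f : hom x y), compm f (idm x) = f;
  compmA : forall x y z t (h : hom z t) (g : hom y z) (f : hom x y),
    compm h (compm g f) = compm (compm h g) f }.

Arguments hom {c} x y.
Arguments idm {c} x.
Arguments compm {c x y z} g f.

Notation "g ∘ f" := (compm g f) (at level 40, left associativity) : cat_scope.

Definition op (C : category) : category :=
  @Category C (fun x y => hom y x) idm (fun _ _ _ g f => f ∘ g)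
    (fun _ _ f => compm1 f) (fun _ _ f => comp1m f)
    (fun _ _ _ _ h g f => esym (compmA f g h)).

Record functor (C D : category) := Functor {
  fob :> C -> D;
  fmap : forall x y, hom x y -> hom (fob x) (fob y);
  fmap1 : forall x, fmap (idm x) = idm (fob x);
  fmapM : forall x y z (g : hom y z) (f : hom x y),
    fmap (g ∘ f) = fmap g ∘ fmap f }.

Record nattrans (C D : category) (F G : functor C D) := NatTrans {
  ncomp :> forall x, hom (F x) (G x);
  ncompP : forall x y (u : hom x y), ncomp y ∘ fmap F u = fmap G u ∘ ncomp x }.

Lemma nattransP (C D : category) (F G : functor C D) (a b : nattrans F G) :
  (forall x, a x = b x) -> a = b.
Proof.
case: a b => [a aP] [b bP] /= ab.
have {}ab : a = b by apply: functional_extensionality_dep.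
by case: _ / ab bP => bP; congr NatTrans; apply: Prop_irrelevance.
Qed.

Lemma nat_id_subproof (C D : category) (F : functor C D) x y (u : hom x y) :
  idm (F y) ∘ fmap F u = fmap F u ∘ idm (F x).
Proof. by rewrite comp1m compm1. Qed.

Lemma nat_comp_subproof (C D : category) (F G H : functor C D)
    (b : nattrans G H) (a : nattrans F G) x y (u : hom x y) :
  (b y ∘ a y) ∘ fmap F u = fmap H u ∘ (b x ∘ a x).
Proof. by rewrite -compmA ncompP compmA ncompP -compmA. Qed.

Definition nat_id (C D : category) (F : functor C D) : nattrans F F :=
  NatTrans (@nat_id_subproof C D F).

Definition nat_comp (C D : category) (F G H : functor C D)
    (b : nattrans G H) (a : nattrans F G) : nattrans F H :=
  NatTrans (nat_comp_subproof b a).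

Program Definition functor_category (C D : category) : category :=
  @Category (functor C D) (@nattrans C D) (@nat_id C D) (@nat_comp C D)
    _ _ _.
Next Obligation. by apply: nattransP => z; apply: comp1m. Qed.
Next Obligation. by apply: nattransP => z; apply: compm1. Qed.
Next Obligation. by apply: nattransP => w; apply: compmA. Qed.

(** * Finite limits and colimits *)

Definition finite_category (J : category) : Prop :=
  finite_set [set: J] /\ forall i j : J, finite_set [set: hom i j].

Section Limits.
Variable C : category.

Definition is_cone (J : category) (F : functor J C) (X : C)
    (q : forall j, hom X (F j)) : Prop :=
  forall i j (u : hom i j), fmap F u ∘ q i = q j.

Definition is_cocone (J : category) (F : functor J C) (X : C)
    (q : forall j, hom (F j) X) : Prop :=
  forall i j (u : hom i j), q j ∘ fmap F u = q i.

Definition is_limit (J : category) (F : functor J C) (L : C)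
    (p : forall j, hom L (F j)) : Prop :=
  is_cone p /\
  forall X (q : forall j, hom X (F j)), is_cone q ->
    exists! h : hom X L, forall j, p j ∘ h = q j.

Definition is_colimit (J : category) (F : functor J C) (L : C)
    (p : forall j, hom (F j) L) : Prop :=
  is_cocone p /\
  forall X (q : forall j, hom (F j) X), is_cocone q ->
    exists! h : hom L X, forall j, h ∘ p j = q j.

Definition has_finite_limits : Prop :=
  forall (J : category) (F : functor J C), finite_category J ->
    exists L (p : forall j, hom L (F j)), is_limit p.

Definition has_finite_colimits : Prop :=
  forall (J : category) (F : functor J C), finite_category J ->
    exists L (p : forall j, hom (F j) L), is_colimit p.

Definition is_pullback (P X Y Z : C) (p1 : hom P X) (p2 : hom P Y)
    (f : hom X Z) (g : hom Y Z) : Prop :=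
  f ∘ p1 = g ∘ p2 /\
  forall T (a : hom T X) (b : hom T Y), f ∘ a = g ∘ b ->
    exists! h : hom T P, p1 ∘ h = a /\ p2 ∘ h = b.

Definition is_coequalizer (X Y Q : C) (q : hom Y Q) (u v : hom X Y) : Prop :=
  q ∘ u = q ∘ v /\
  forall T (a : hom Y T), a ∘ u = a ∘ v -> exists! h : hom Q T, h ∘ q = a.

Definition is_coproduct (X Y S : C) (i1 : hom X S) (i2 : hom Y S) : Prop :=
  forall T (a : hom X T) (b : hom Y T),
    exists! h : hom S T, h ∘ i1 = a /\ h ∘ i2 = b.

Definition is_iso (X Y : C) (f : hom X Y) : Prop :=
  exists g : hom Y X, g ∘ f = idm X /\ f ∘ g = idm Y.

Definition is_zero_object (Z : C) : Prop :=
  forall X : C, (exists! f : hom X Z, True) /\ (exists! f : hom Z X, True).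

Definition is_zero_map (X Y : C) (f : hom X Y) : Prop :=
  exists (Z : C) (g : hom X Z) (h : hom Z Y), is_zero_object Z /\ f = h ∘ g.

Definition is_kernel (K X Y : C) (k : hom K X) (f : hom X Y) : Prop :=
  is_zero_map (f ∘ k) /\
  forall T (a : hom T X), is_zero_map (f ∘ a) -> exists! h : hom T K, k ∘ h = a.

Definition is_cokernel (X Y Q : C) (q : hom Y Q) (f : hom X Y) : Prop :=
  is_zero_map (q ∘ f) /\
  forall T (a : hom Y T), is_zero_map (a ∘ f) -> exists! h : hom Q T, h ∘ q = a.

Definition factors_through (X Y Z : C) (g : hom Y X) (s : hom Z X) : Prop :=
  exists h : hom Y Z, s ∘ h = g.

(* The intersection of a family of subobjects [s i] of [X]. *)
Definition is_intersection (I : Type) (X : C) (S : I -> C)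
    (s : forall i, hom (S i) X) (T : C) (t : hom T X) : Prop :=
  (forall i, factors_through t (s i)) /\
  forall Y (g : hom Y X), (forall i, factors_through g (s i)) ->
    exists! h : hom Y T, t ∘ h = g.

End Limits.

(** * Semi-abelian categories *)

Section SemiAbelian.
Variable C : category.

Definition pointed : Prop := exists Z : C, is_zero_object Z.

Definition regular_epi (X Y : C) (f : hom X Y) : Prop :=
  exists (W : C) (u v : hom W X), is_coequalizer f u v.

Definition is_kernel_pair (R X Y : C) (r1 r2 : hom R X) (f : hom X Y) : Prop :=
  is_pullback r1 r2 f f.

Record regular_category : Prop := RegularCategory {
  regular_limits : has_finite_limits C;
  regular_coeq : forall (R X Y : C) (r1 r2 : hom R X) (f : hom X Y),
    is_kernel_pair r1 r2 f -> exists (Q : C) (q : hom X Q), is_coequalizer q r1 r2;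
  regular_stable : forall (P X Y Z : C) (p1 : hom P X) (p2 : hom P Y)
      (f : hom X Z) (g : hom Y Z),
    is_pullback p1 p2 f g -> regular_epi f -> regular_epi p2 }.

Record equivalence_relation (R X : C) (r1 r2 : hom R X) : Prop :=
  EquivalenceRelation {
    eqrel_mono : forall T (a b : hom T R),
      r1 ∘ a = r1 ∘ b -> r2 ∘ a = r2 ∘ b -> a = b;
    eqrel_refl : exists e : hom X R, r1 ∘ e = idm X /\ r2 ∘ e = idm X;
    eqrel_sym : exists s : hom R R, r1 ∘ s = r2 /\ r2 ∘ s = r1;
    eqrel_trans : forall P (p1 p2 : hom P R), is_pullback p1 p2 r2 r1 ->
      exists t : hom P R, r1 ∘ t = r1 ∘ p1 /\ r2 ∘ t = r2 ∘ p2 }.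

Record exact_category : Prop := ExactCategory {
  exact_regular : regular_category;
  exact_effective : forall (R X : C) (r1 r2 : hom R X),
    equivalence_relation r1 r2 ->
    exists (Y : C) (f : hom X Y), is_kernel_pair r1 r2 f }.

Definition short_five_lemma : Prop :=
  forall (K X Y K' X' Y' : C)
    (k : hom K X) (f : hom X Y) (k' : hom K' X') (f' : hom X' Y')
    (u : hom K K') (v : hom X X') (w : hom Y Y'),
    regular_epi f -> is_kernel k f -> regular_epi f' -> is_kernel k' f' ->
    v ∘ k = k' ∘ u -> w ∘ f = f' ∘ v ->
    is_iso u -> is_iso w -> is_iso v.

Record semi_abelian : Prop := SemiAbelian {
  semi_abelian_pointed : pointed;
  semi_abelian_exact : exact_category;
  semi_abelian_protomodular : short_five_lemma;
  semi_abelian_coproducts : forall X Y : C,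
    exists (S : C) (i1 : hom X S) (i2 : hom Y S), is_coproduct i1 i2 }.

Definition projective (P : C) : Prop :=
  forall (X Y : C) (f : hom X Y), regular_epi f ->
    forall g : hom P Y, exists h : hom P X, f ∘ h = g.

Definition enough_projectives : Prop :=
  forall X : C, exists (P : C) (p : hom P X), projective P /\ regular_epi p.

End SemiAbelian.

(** * Closed model structures *)

Section Model.
Variable C : category.

Definition map_class := forall X Y : C, hom X Y -> Prop.

Definition llp (A B X Y : C) (i : hom A B) (p : hom X Y) : Prop :=
  forall (a : hom A X) (b : hom B Y), p ∘ a = b ∘ i ->
    exists h : hom B X, h ∘ i = a /\ p ∘ h = b.

Definition is_retract (X Y X' Y' : C) (f : hom X Y) (g : hom X' Y') : Prop :=
  exists (s : hom X X') (r : hom X' X) (s' : hom Y Y') (r' : hom Y' Y),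
    [/\ r ∘ s = idm X, r' ∘ s' = idm Y, g ∘ s = s' ∘ f & f ∘ r = r' ∘ g].

Definition retract_closed (M : map_class) : Prop :=
  forall (X Y X' Y' : C) (f : hom X Y) (g : hom X' Y'),
    is_retract f g -> M _ _ g -> M _ _ f.

Record model_structure := ModelStructure {
  weq : map_class;
  fib : map_class;
  cof : map_class;
  model_limits : has_finite_limits C;
  model_colimits : has_finite_colimits C;
  weq_comp : forall X Y Z (f : hom X Y) (g : hom Y Z),
    weq f -> weq g -> weq (g ∘ f);
  weq_cancell : forall X Y Z (f : hom X Y) (g : hom Y Z),
    weq g -> weq (g ∘ f) -> weq f;
  weq_cancelr : forall X Y Z (f : hom X Y) (g : hom Y Z),
    weq f -> weq (g ∘ f) -> weq g;
  weq_retract : retract_closed weq;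
  fib_retract : retract_closed fib;
  cof_retract : retract_closed cof;
  cofP : forall A B (i : hom A B), cof i <->
    (forall X Y (p : hom X Y), fib p -> weq p -> llp i p);
  trivial_cof_lift : forall A B X Y (i : hom A B) (p : hom X Y),
    cof i -> weq i -> fib p -> llp i p;
  factor_cof_trivial_fib : forall X Y (f : hom X Y),
    exists (E : C) (i : hom X E) (p : hom E Y),
      [/\ cof i, fib p, weq p & f = p ∘ i];
  factor_trivial_cof_fib : forall X Y (f : hom X Y),
    exists (E : C) (i : hom X E) (p : hom E Y),
      [/\ cof i, weq i, fib p & f = p ∘ i] }.

End Model.

(** * Simplicial objects *)

Definition monotone m n (f : {ffun 'I_m.+1 -> 'I_n.+1}) : bool :=
  [forall i : 'I_m.+1, forall j : 'I_m.+1, (i <= j) ==> (f i <= f j)].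

Definition simplex_hom (m n : nat) : Type :=
  {f : {ffun 'I_m.+1 -> 'I_n.+1} | monotone f}.

Definition SimplexHom m n (f : {ffun 'I_m.+1 -> 'I_n.+1}) (fP : monotone f) :
    simplex_hom m n :=
  exist (fun f => is_true (monotone f)) f fP.

Lemma monotone_id_subproof n : monotone (finfun (@id 'I_n.+1)).
Proof.
by apply/forallP => i; apply/forallP => j; apply/implyP; rewrite !ffunE.
Qed.

Lemma monotone_comp_subproof m n p (g : simplex_hom n p) (f : simplex_hom m n) :
  monotone (finfun (fun i => val g (val f i))).
Proof.
apply/forallP => i; apply/forallP => j; apply/implyP => ij; rewrite !ffunE.
apply: (implyP (forallP (forallP (valP g) _) _)).
exact: (implyP (forallP (forallP (valP f) _) _)).
Qed.

Lemma monotone_lift_subproof n (i : 'I_n.+2) :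
  monotone (finfun (fun j : 'I_n.+1 => lift i j)).
Proof.
apply/forallP => j; apply/forallP => k; apply/implyP => jk.
by rewrite !ffunE /= leq_bump2.
Qed.

(* The object [n] stands for the ordinal {0, ..., n} = 'I_n.+1. *)
Program Definition simplex_category : category :=
  @Category nat simplex_hom (fun n => SimplexHom (monotone_id_subproof n))
    (fun m n p g f => SimplexHom (monotone_comp_subproof g f)) _ _ _.
Next Obligation. by apply: val_inj; apply/ffunP => i; rewrite !ffunE. Qed.
Next Obligation. by apply: val_inj; apply/ffunP => i; rewrite !ffunE. Qed.
Next Obligation. by apply: val_inj; apply/ffunP => i; rewrite !ffunE. Qed.

(* The injection {0, ..., n} -> {0, ..., n+1} whose image omits [i]. *)
Definition coface n (i : 'I_n.+2) : @hom simplex_category n n.+1 :=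
  SimplexHom (monotone_lift_subproof i).

Definition simplicial (C : category) : category :=
  functor_category (op simplex_category) C.

Section Simplicial.
Variable C : category.

Definition sob (A : simplicial C) (n : nat) : C := fob A n.

Definition smap (A B : simplicial C) (f : hom A B) n : hom (sob A n) (sob B n) :=
  ncomp f n.

Definition face (A : simplicial C) n (i : 'I_n.+2) :
    hom (sob A n.+1) (sob A n) :=
  @fmap _ _ A n.+1 n (coface i).

(** ** Homology *)

(* Kernels, intersections and cokernels are only determined up to isomorphism,
   so the Moore complex and the homology objects are described by the data of
   all the universal objects that enter their construction. *)

Record moore_complex (A : simplicial C) := MooreComplex {
  moore_ob :> nat -> C;
  moore_incl : forall n, hom (moore_ob n) (sob A n);
  moore_incl0 : is_iso (moore_incl 0);
  moore_inclS : forall n,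
    exists (K : 'I_n.+1 -> C) (k : forall i, hom (K i) (sob A n.+1)),
      (forall i : 'I_n.+1, is_kernel (k i) (face A (widen_ord (leqnSn n.+1) i)))
      /\ is_intersection k (moore_incl n.+1);
  moore_d : forall n, hom (moore_ob n.+1) (moore_ob n);
  moore_dE : forall n,
    moore_incl n ∘ moore_d n = face A ord_max ∘ moore_incl n.+1 }.

(* [z] is a kernel of the differential leaving degree [n]. In degree 0 that
   differential is the map to the zero object. *)
Definition is_cycles (A : simplicial C) (N : moore_complex A) (n : nat) (Z : C) :
    hom Z (N n) -> Prop :=
  match n return hom Z (N n) -> Prop with
  | 0 => fun z => is_iso z
  | m.+1 => fun z => is_kernel z (moore_d N m)
  end.

Record homology (A : simplicial C) (n : nat) := Homology {
  hmoore : moore_complex A;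
  hcycles : C;
  hcycles_incl : hom hcycles (hmoore n);
  hcyclesP : is_cycles hcycles_incl;
  hbound : hom (hmoore n.+1) hcycles;
  hboundP : hcycles_incl ∘ hbound = moore_d hmoore n;
  hob :> C;
  hproj : hom hcycles hob;
  hprojP : is_cokernel hproj hbound }.

Definition is_homology_map (A B : simplicial C) (f : hom A B) n
    (HA : homology A n) (HB : homology B n) (h : hom HA HB) : Prop :=
  exists (fN : hom (hmoore HA n) (hmoore HB n))
         (fZ : hom (hcycles HA) (hcycles HB)),
    [/\ moore_incl (hmoore HB) n ∘ fN = smap f n ∘ moore_incl (hmoore HA) n,
        hcycles_incl HB ∘ fZ = fN ∘ hcycles_incl HA
      & h ∘ hproj HA = hproj HB ∘ fZ].

(* Since homology objects and induced maps are unique up to a unique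
   isomorphism, invertibility does not depend on the choice of [HA] and [HB]. *)
Definition homology_iso (A B : simplicial C) (f : hom A B) : Prop :=
  forall n, exists (HA : homology A n) (HB : homology B n) (h : hom HA HB),
    is_homology_map f h /\ is_iso h.

(** ** Kan fibrations *)

(* An [(n+1, k)]-horn of [A]. The faces of the [x i] only exist for [n > 0];
   for [n = 0] the family has a single member and there is no condition. In the
   other case, [i < j] ensures that [inord] does not truncate [i] or [j.-1]. *)
Definition is_horn (A : simplicial C) (X : C) n (k : 'I_n.+2) :
    (forall i : 'I_n.+2, i != k -> hom X (sob A n)) -> Prop :=
  match n return forall k : 'I_n.+2,
      (forall i : 'I_n.+2, i != k -> hom X (sob A n)) -> Prop with
  | 0 => fun k x => True
  | m.+1 => fun k x =>
      forall (i j : 'I_m.+3) (ik : i != k) (jk : j != k), i < j ->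
        face A (inord i : 'I_m.+2) ∘ x j jk =
        face A (inord j.-1 : 'I_m.+2) ∘ x i ik
  end k.

Definition kan_fibration (A B : simplicial C) (f : hom A B) : Prop :=
  forall n (k : 'I_n.+2) (X : C)
    (x : forall i : 'I_n.+2, i != k -> hom X (sob A n)) (b : hom X (sob B n.+1)),
    is_horn x ->
    (forall (i : 'I_n.+2) (ik : i != k), face B i ∘ b = smap f n ∘ x i ik) ->
    exists (Y : C) (p : hom Y X) (a : hom Y (sob A n.+1)),
      [/\ regular_epi p, smap f n.+1 ∘ a = b ∘ p
        & forall (i : 'I_n.+2) (ik : i != k), face A i ∘ a = x i ik ∘ p].

End Simplicial.

(* Main.v *)
From mathcomp Require Import all_boot.
From mathcomp Require Import boolp classical_sets cardinality.
From mathcomp Require Import zify.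
Require Import Defs.

(** Let the elements of an object be the maps into it with projective domain.
    Regular epimorphisms are exactly the maps which are surjective on elements
    ([surjective_regular_epi]), so that most statements about [C] can be proved
    with elements. What replaces the group structure used for simplicial groups
    is [subtraction_exists]: elements with domain [P] have natural differences
    [x - y], whose domain is another projective object, and [x] can be recovered
    from [x - y] and [y]. This follows from the Short Five Lemma for the split
    extension [P + P -> P]. In particular there is a natural Mal'tsev operation
    [x - y + z], from which it follows, with exactness, that the coequalizer of
    a reflexive graph identifies only related elements ([reflexive_quotient]).
    This provides the finite colimits of [C], and it computes homology: the
    elements of the homology objects are the cycles up to the relation
    [homologous], and a homology isomorphism is a bijection on those classes
    ([homology_isoE]).

    Call a simplex normal if all its faces but the last one are null. As in a
    simplicial group, every horn has a filler ([horn_filler]), and a Kan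
    fibration is a map which is surjective on normal simplices of positive degree
    ([kan_fibrationE]), that is, which has the right lifting property for the
    maps from 0 to the disks of positive dimension. Those among them which are homology isomorphisms
    are the maps with the right lifting property for the inclusions of spheres
    into disks ([fibration_disk_lifting], [disk_lifting_homology]).

    The factorizations are then obtained by attaching cells with projective
    coefficients, in the manner of projective resolutions of chain complexes. For
    a trivial cofibration followed by a fibration, add to the domain all disks of
    the codomain in a single step ([factor_disk_extension]); disks can be
    contracted, whence the inclusion is a homology isomorphism. For a cofibration
    followed by a trivial fibration, attach cells dimension after dimension to
    solve the lifting problems of the preceding stage ([factor_cofibration]). In
    each degree only finitely many cells occur, so that finite coproducts
    suffice, and only finitely many stages are different. The lifting of trivial
    cofibrations against fibrations comes from the retract argument, the
    inclusion into a disk extension being liftable against all fibrations. *)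

Set Implicit Arguments.
Unset Strict Implicit.
Unset Printing Implicit Defensive.
Local Open Scope cat_scope.

(** * Maps and finite limits *)

Definition mono (C : category) (X Y : C) (f : hom X Y) : Prop :=
  forall T (a b : hom T X), f ∘ a = f ∘ b -> a = b.

Definition epi (C : category) (X Y : C) (f : hom X Y) : Prop :=
  forall T (a b : hom Y T), a ∘ f = b ∘ f -> a = b.

Section Generalities.
Variable C : category.

Lemma is_iso_idm (X : C) : is_iso (idm X).
Proof. by exists (idm X); rewrite comp1m. Qed.

Lemma is_iso_comp (X Y Z : C) (g : hom Y Z) (f : hom X Y) :
  is_iso g -> is_iso f -> is_iso (g ∘ f).
Proof.
move=> [g' [g'g gg']] [f' [f'f ff']]; exists (f' ∘ g'); split.
  by rewrite -compmA (compmA g') g'g comp1m.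
by rewrite -compmA (compmA f) ff' comp1m.
Qed.

Lemma is_iso_mono (X Y : C) (f : hom X Y) : is_iso f -> mono f.
Proof.
by move=> [g [gf _]] T a b /(congr1 (compm g)); rewrite !compmA gf !comp1m.
Qed.

Lemma regular_epi_epi (X Y : C) (f : hom X Y) : regular_epi f -> epi f.
Proof.
move=> [W [u [v [fuv fun_]]]] T a b ab.
have /fun_[h [_ hu]] : (b ∘ f) ∘ u = (b ∘ f) ∘ v by rewrite -!compmA fuv.
by rewrite -(hu a) // -(hu b).
Qed.

Lemma split_regular_epi (X Y : C) (f : hom X Y) (s : hom Y X) :
  f ∘ s = idm Y -> regular_epi f.
Proof.
move=> fs; exists X, (idm X), (s ∘ f); split.
  by rewrite compm1 compmA fs comp1m.
move=> T a; rewrite compm1 compmA => ass; exists (a ∘ s); split => // h <-.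
by rewrite -compmA fs compm1.
Qed.

Lemma regular_epi_comp_iso (X Y Z : C) (g : hom Y Z) (f : hom X Y) :
  is_iso g -> regular_epi f -> regular_epi (g ∘ f).
Proof.
move=> [g' [g'g gg']] [W [u [v [fuv fun_]]]]; exists W, u, v; split.
  by rewrite -!compmA fuv.
move=> T a /fun_[h [hf hu]]; exists (h ∘ g'); split.
  by rewrite -compmA (compmA g') g'g comp1m.
move=> k; rewrite compmA => /hu ->; by rewrite -compmA gg' compm1.
Qed.

Lemma regular_epi_mono_iso (X Y Z : C) (m : hom Y Z) (t : hom X Y) :
  mono m -> regular_epi (m ∘ t) -> is_iso m.
Proof.
move=> mm mt; have mte := regular_epi_epi mt.
case: mt => W [u [v [e eu]]].
have /eu[s [st _]] : t ∘ u = t ∘ v by apply: mm; rewrite !compmA.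
have ms : m ∘ s = idm Z by apply: mte; rewrite -compmA st comp1m.
by exists s; split=> //; apply: mm; rewrite compmA ms comp1m compm1.
Qed.

End Generalities.

Section FiniteLimits.
Variable C : category.
Hypothesis limC : has_finite_limits C.

Definition discrete_bool : category :=
  @Category bool (fun i j => i = j) (@erefl bool)
    (fun _ _ _ g f => etrans f g)
    (fun _ _ f => Prop_irrelevance _ _) (fun _ _ f => Prop_irrelevance _ _)
    (fun _ _ _ _ h g f => Prop_irrelevance _ _).

Lemma finite_all (T : finType) : finite_set [set: T].
Proof. exact: finite_finset. Qed.

Lemma binary_product (X Y : C) : exists (P : C) (p : hom P X) (q : hom P Y),
  (forall T (a b : hom T P), p ∘ a = p ∘ b -> q ∘ a = q ∘ b -> a = b) /\
  (forall T (a : hom T X) (b : hom T Y), exists h, p ∘ h = a /\ q ∘ h = b).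
Proof.
pose o (i : discrete_bool) : C := if i then X else Y.
pose F := @Functor discrete_bool C o
  (fun i j (e : i = j) => match e in _ = j return hom (o i) (o j) with
                          | erefl => idm (o i) end)
  (fun _ => erefl)
  (fun i j k g f => match g in _ = k return
     (match etrans f g in _ = k' return hom (o i) (o k') with
      | erefl => idm _ end)
     = (match g in _ = k' return hom (o j) (o k') with erefl => idm _ end) ∘
       (match f in _ = j' return hom (o i) (o j') with erefl => idm _ end)
    with erefl => match f with erefl => esym (comp1m _) end end).
have fJ : finite_category discrete_bool.
  split; first exact: finite_all.
  move=> i j; case: (pselect (i = j)) => [e|ne].
    apply: (@sub_finite_set _ _ [set e]%classic); last exact: finite_set1.
    by move=> f _; exact: (Prop_irrelevance f e).
  by apply: (@sub_finite_set _ _ set0) => // f; case: (ne f).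
have [L [p [_ Lu]]] := limC F fJ.
exists L, (p true), (p false); split=> [T a b pa qa|T a b].
  have /Lu[h [_ hu]] : is_cone (F := F) (fun i => p i ∘ a).
    by move=> i j u; case: _ / u; exact: comp1m.
  by rewrite -(hu a) // -(hu b) //; case.
have /Lu[h [hp _]] : is_cone (F := F)
    (fun i => match i return hom T (o i) with true => a | false => b end).
  by move=> i j u; case: _ / u; exact: comp1m.
by exists h; rewrite (hp true) (hp false).
Qed.

Definition arrow_hom (i j : bool) : Type :=
  match i, j with
  | false, true => bool | true, false => void | _, _ => unit end.

Definition arrow_comp i j k : arrow_hom j k -> arrow_hom i j -> arrow_hom i k :=
  match i, j, k return arrow_hom j k -> arrow_hom i j -> arrow_hom i k with
  | false, false, false => fun _ _ => tt
  | true, true, true => fun _ _ => tt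
  | false, false, true => fun g _ => g
  | false, true, true => fun _ f => f
  | false, true, false => fun _ _ => tt
  | true, false, k => fun _ f => match f with end
  | true, true, false => fun g _ => g
  end.

Program Definition parallel_arrows : category :=
  @Category bool arrow_hom
    (fun i => match i return arrow_hom i i with true => tt | false => tt end)
    arrow_comp _ _ _.
Next Obligation. by case: x y f => [] [] // []. Qed.
Next Obligation. by case: x y f => [] [] // []. Qed.
Next Obligation. by case: x y z t f g h => [] [] [] [] // [] // [] // []. Qed.

Definition parallel_ob (X Y : C) (i : bool) : C := if i then Y else X.

Definition parallel_map (X Y : C) (u v : hom X Y) (i j : bool) :
    arrow_hom i j -> hom (parallel_ob X Y i) (parallel_ob X Y j) :=
  match i, j return arrow_hom i j -> hom (parallel_ob X Y i) (parallel_ob X Y j)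
  with
  | true, true => fun _ => idm Y
  | false, false => fun _ => idm X
  | false, true => fun b => if b then u else v
  | true, false => fun f => match f with end
  end.

Program Definition parallel_functor (X Y : C) (u v : hom X Y) :
    functor parallel_arrows C :=
  @Functor parallel_arrows C (parallel_ob X Y) (parallel_map u v) _ _.
Next Obligation. by case: x. Qed.
Next Obligation.
by case: x y z f g => [] [] [] // [] //= *; rewrite ?comp1m ?compm1.
Qed.

Lemma equalizer (X Y : C) (u v : hom X Y) : exists (E : C) (e : hom E X),
  [/\ mono e, u ∘ e = v ∘ e &
  forall T (a : hom T X), u ∘ a = v ∘ a -> exists h, e ∘ h = a].
Proof.
have fJ : finite_category parallel_arrows.
  split; first exact: (finite_all bool).
  by case=> [] []; [exact: (finite_all unit) | exact: (finite_all void)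
    | exact: (finite_all bool) | exact: (finite_all unit)].
have [L [p [pc Lu]]] := limC (parallel_functor u v) fJ.
have cone T (a : hom T X) : u ∘ a = v ∘ a ->
    is_cone (F := parallel_functor u v)
      (fun i => match i return hom T (parallel_ob X Y i) with
                | true => u ∘ a | false => a end).
  by move=> ua [] [] [] //=; rewrite ?comp1m.
have pE b : p true = (if b then u else v) ∘ p false.
  by rewrite -(pc false true b).
exists L, (p false); split=> [T a b pa||T a /cone/Lu[h [hp _]]].
- have [|h [_ hu]] := Lu _ (fun i => p i ∘ a).
    by move=> i j w; rewrite compmA pc.
  rewrite -(hu a) // -(hu b) // => -[] //.
  by rewrite (pE true) -!compmA pa.
- by rewrite -(pE true) (pE false).
- by exists h; rewrite (hp false).
Qed.

Lemma pullback (X Y Z : C) (f : hom X Z) (g : hom Y Z) :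
  exists (P : C) (p : hom P X) (q : hom P Y), is_pullback p q f g.
Proof.
have [B [p [q [pq_mono pq_ex]]]] := binary_product X Y.
have [E [e [e_mono fe e_ex]]] := equalizer (f ∘ p) (g ∘ q).
exists E, (p ∘ e), (q ∘ e); split; first by rewrite !compmA.
move=> T a b fab; have [k [ka kb]] := pq_ex T a b.
have [|h hk] := e_ex T k; first by rewrite -!compmA ka kb.
exists h; split; first by rewrite -!compmA hk.
move=> h' [pa qb]; apply: e_mono; apply: pq_mono.
  by rewrite hk ka !compmA pa.
by rewrite hk kb !compmA qb.
Qed.

End FiniteLimits.

(** * Zero maps and elements with projective domain *)

Section Zero.
Variables (C : category) (hC : semi_abelian C).

Definition zero_ob : C := projT1 (cid (semi_abelian_pointed hC)).

Lemma zero_obP : is_zero_object zero_ob.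
Proof. exact: (projT2 (cid (semi_abelian_pointed hC))). Qed.

Definition zero (X Y : C) : hom X Y :=
  projT1 (cid (zero_obP Y).2) ∘ projT1 (cid (zero_obP X).1).

Lemma zero_object_maps (Z X Y : C) (g g' : hom X Z) (h h' : hom Z Y) :
  is_zero_object Z -> g = g' /\ h = h'.
Proof.
move=> zZ; have [[k [_ ku]] _] := zZ X; have [_ [l [_ lu]]] := zZ Y.
by rewrite -(ku g) // -(ku g') // -(lu h) // -(lu h').
Qed.

Lemma is_zero_mapE (X Y : C) (f : hom X Y) : is_zero_map f <-> f = zero X Y.
Proof.
split=> [[Z [g [h [zZ ->]]]]|->]; last first.
  exists zero_ob, (projT1 (cid (zero_obP X).1)), (projT1 (cid (zero_obP Y).2)).
  by split=> //; exact: zero_obP.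
rewrite /zero; set a := projT1 _; set b := projT1 _.
have [[z _] _] := zZ zero_ob; have [_ [z' _]] := zZ zero_ob.
have [-> _] := zero_object_maps g (z ∘ b) h h zZ.
have [_ ->] := zero_object_maps b b a (h ∘ z) zero_obP.
by rewrite compmA.
Qed.

Lemma zero_comp (X Y Z : C) (f : hom X Y) : zero Y Z ∘ f = zero X Z.
Proof.
apply/is_zero_mapE; rewrite /zero -compmA.
by do 3![eexists]; split; first exact: zero_obP.
Qed.

Lemma comp_zero (X Y Z : C) (f : hom Y Z) : f ∘ zero X Y = zero X Z.
Proof.
apply/is_zero_mapE; rewrite /zero compmA.
by do 3![eexists]; split; first exact: zero_obP.
Qed.

Lemma is_kernelE (K X Y : C) (k : hom K X) (f : hom X Y) :
  is_kernel k f <-> [/\ mono k, f ∘ k = zero K Y &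
    forall T (a : hom T X), f ∘ a = zero T Y -> exists h, k ∘ h = a].
Proof.
split=> [[/is_zero_mapE k0 ku]|[km k0 ku]].
  split=> // [T a b kab|T a fa].
    have /ku[h [_ hu]] : is_zero_map (f ∘ (k ∘ a)).
      by apply/is_zero_mapE; rewrite compmA k0 zero_comp.
    by rewrite -(hu a) // -(hu b).
  by have /is_zero_mapE/ku[h [hk _]] := fa; exists h.
split; first exact/is_zero_mapE.
move=> T a /is_zero_mapE /ku[h hk]; exists h; split => // h' hk'.
by apply: km; rewrite hk.
Qed.

Lemma kernel_exists (X Y : C) (f : hom X Y) :
  exists (K : C) (k : hom K X), is_kernel k f.
Proof.
have limC := regular_limits (exact_regular (semi_abelian_exact hC)).
have [K [k [km fk ku]]] := equalizer limC f (zero X Y).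
exists K, k; apply/is_kernelE; split=> //; first by rewrite fk zero_comp.
by move=> T a fa; apply: ku; rewrite fa zero_comp.
Qed.

End Zero.

Section Elements.
Variables (C : category) (hC : semi_abelian C) (hP : enough_projectives C).

Let regC : regular_category C := exact_regular (semi_abelian_exact hC).
Let limC : has_finite_limits C := regular_limits regC.

(** The elements of an object are the maps into it with projective domain. As
    there are enough projectives, equality of maps, monomorphisms and regular
    epimorphisms are all detected on elements; [surjective_regular_epi] is the
    converse of what projectivity says. *)
Definition surjective (X Y : C) (f : hom X Y) : Prop :=
  forall P, projective P -> forall y : hom P Y, exists x : hom P X, f ∘ x = y.

Lemma element_ext (X Y : C) (f g : hom X Y) :
  (forall P (x : hom P X), projective P -> f ∘ x = g ∘ x) -> f = g.
Proof.
move=> fg; have [P [p [pP pe]]] := hP X.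
by apply: (regular_epi_epi pe); exact: fg.
Qed.

Lemma element_mono (X Y : C) (f : hom X Y) :
  (forall P (a b : hom P X), projective P -> f ∘ a = f ∘ b -> a = b) -> mono f.
Proof.
move=> fm T a b fab; apply: element_ext => P x pP.
by apply: fm => //; rewrite !compmA fab.
Qed.

(** A factorization on a projective cover descends, the cover being the
    coequalizer of some pair of maps. *)
Lemma element_factor (S X Y : C) (m : hom S X) (g : hom Y X) : mono m ->
  (forall P (y : hom P Y), projective P -> exists t, m ∘ t = g ∘ y) ->
  exists h, m ∘ h = g.
Proof.
move=> mm ex; have [P [p [pP pe]]] := hP Y.
have [t mt] := ex P p pP; have [W [u [v [puv pu]]]] := pe.
have /pu[h [hp _]] : t ∘ u = t ∘ v.
  by apply: mm; rewrite !compmA mt -!compmA puv.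
by exists h; apply: (regular_epi_epi pe); rewrite -compmA hp.
Qed.

Lemma kernel_pair_exists (X Y : C) (f : hom X Y) :
  exists (R : C) (r s : hom R X), is_kernel_pair r s f.
Proof. exact: pullback. Qed.

(** Projectivity makes the usual proof short: two elements of the coequalizer of
    the kernel pair lift to [X], and lifts with the same image in [Y] form an
    element of the kernel pair. *)
Lemma image_factorization (X Y : C) (f : hom X Y) :
  exists (I : C) (m : hom I Y) (e : hom X I),
    [/\ mono m, regular_epi e & f = m ∘ e].
Proof.
have [R [r [s rs]]] := kernel_pair_exists f.
have [I [e [ers eu]]] := regular_coeq regC rs.
have ee : regular_epi e by exists R, r, s.
have [m [me _]] := eu _ f rs.1.
exists I, m, e; split => //; apply: element_mono => P a b pP mab.
have [a' ea] := pP _ _ e ee a; have [b' eb] := pP _ _ e ee b.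
have [|h [[ra sb] _]] := rs.2 P a' b'; first by rewrite -me -!compmA ea eb.
by rewrite -ea -eb -ra -sb !compmA ers.
Qed.

Lemma surjective_regular_epi (X Y : C) (f : hom X Y) :
  surjective f -> regular_epi f.
Proof.
move=> fs; have [I [m [e [mm ee fE]]]] := image_factorization f.
have [P [p [pP pe]]] := hP Y; have [x fx] := fs P pP p.
rewrite fE; apply: regular_epi_comp_iso => //.
by apply: (@regular_epi_mono_iso _ _ _ _ m (e ∘ x)); rewrite // compmA -fE fx.
Qed.

Lemma element_iso (X Y : C) (f : hom X Y) :
  mono f -> surjective f -> is_iso f.
Proof.
move=> fm /surjective_regular_epi fe.
by apply: (@regular_epi_mono_iso _ X _ _ f (idm X)) => //; rewrite compm1.
Qed.

(** ** The subtraction of elements *)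

(** The Short Five Lemma compares [T], again a split extension of [Y] by [K],
    with [X]. Applied to the image of [k] and [s], this makes the kernel and the
    section of a split extension jointly strongly epimorphic. *)
Lemma split_extension_cover (K X Y T : C) (k : hom K X) (f : hom X Y)
    (s : hom Y X) (m : hom T X) :
  is_kernel k f -> f ∘ s = idm Y -> mono m ->
  (exists k', m ∘ k' = k) -> (exists s', m ∘ s' = s) -> is_iso m.
Proof.
move=> kk fs mm [k' mk] [s' ms].
have fm : regular_epi (f ∘ m).
  by apply: (split_regular_epi (s := s')); rewrite -compmA ms.
apply: (@semi_abelian_protomodular C hC K T Y K X Y k' (f ∘ m) k f
  (idm K) m (idm Y)) => //; try exact: is_iso_idm.
- move/(is_kernelE hC): kk => [km k0 ku]; apply/(is_kernelE hC); split.
  + by move=> U a b /(congr1 (compm m)); rewrite !compmA mk => /km.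
  + by rewrite -compmA mk.
  + move=> U a; rewrite -compmA => /ku[h hk]; exists h.
    by apply: mm; rewrite compmA mk.
- exact: split_regular_epi fs.
- by rewrite compm1.
- by rewrite comp1m.
Qed.

(** For a projective object [P], the elements with domain [P] carry natural
    operations which are those of a protomodular variety (with a single
    subtraction, whose values are elements over another projective object). *)
Record subtraction (P : C) := Subtraction {
  sub_dom : C;
  sub_proj : projective sub_dom;
  sub_op : forall A : C, hom P A -> hom P A -> hom sub_dom A;
  sub_add : forall A : C, hom sub_dom A -> hom P A -> hom P A;
  sub_opN : forall (A B : C) (f : hom A B) x y,
    f ∘ sub_op x y = sub_op (f ∘ x) (f ∘ y);
  sub_addN : forall (A B : C) (f : hom A B) z y,
    f ∘ sub_add z y = sub_add (f ∘ z) (f ∘ y);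
  sub_self : forall (A : C) (x : hom P A), sub_op x x = zero hC _ _;
  sub_addK : forall (A : C) (x y : hom P A), sub_add (sub_op x y) y = x }.

(** The element [k] of [P + P] covers the kernel of the codiagonal. By
    [split_extension_cover] the map [c] from [Q + P] to [P + P] given by [k] and
    the second inclusion is a regular epimorphism, so that the first inclusion
    lifts along it. Composition with [k] and with the lifting [t] are the
    operations. *)
Lemma subtraction_exists (P : C) : projective P -> exists _ : subtraction P, True.
Proof.
move=> pP.
have copair := fun (X Y Z : C) (i : hom X Z) (j : hom Y Z) (c : is_coproduct i j) T
  (a : hom X T) (b : hom Y T) => cid (c T a b).
have [S [i [j ij]]] := semi_abelian_coproducts hC P P.
have [nabla [[ni nj] _]] := ij P (idm P) (idm P).
have [K [k0 kk]] := kernel_exists hC nabla.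
have [Q [q [pQ qe]]] := hP K.
pose k := k0 ∘ q.
have nk : nabla ∘ k = zero hC Q P.
  by move/(is_kernelE hC): kk => [_ kk _]; rewrite compmA kk zero_comp.
have [T [a [b ab]]] := semi_abelian_coproducts hC Q P.
have [c [[ca cb] _]] := ab S k j.
have ce : regular_epi c.
  have [I [m [e [mm ee cE]]]] := image_factorization c.
  rewrite cE; apply: regular_epi_comp_iso => //.
  apply: (split_extension_cover kk nj mm); last first.
    by exists (e ∘ b); rewrite compmA -cE.
  apply: element_factor => // P' x pP'.
  have [y qy] := pP' _ _ q qe x; exists (e ∘ (a ∘ y)).
  by rewrite !compmA -cE ca -compmA qy.
have [t ct] := pP _ _ c ce i.
pose op A (x y : hom P A) := projT1 (copair _ _ _ i j ij A x y) ∘ k.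
pose add A (z : hom Q A) (y : hom P A) := projT1 (copair _ _ _ a b ab A z y) ∘ t.
have opE A (x y : hom P A) (h : hom S A) :
    h ∘ i = x -> h ∘ j = y -> op A x y = h ∘ k.
  rewrite /op => hx hy; case: (copair _ _ _ i j ij A x y) => h' /= [_ hu].
  congr (_ ∘ _).
  exact: hu.
have addE A (z : hom Q A) (y : hom P A) (h : hom T A) :
    h ∘ a = z -> h ∘ b = y -> add A z y = h ∘ t.
  rewrite /add => hx hy; case: (copair _ _ _ a b ab A z y) => h' /= [_ hu].
  congr (_ ∘ _).
  exact: hu.
unshelve eexists (@Subtraction P Q pQ op add _ _ _ _) => //.
- move=> A B f x y; have [h [[hx hy] _]] := ij A x y.
  by rewrite (opE _ _ _ h) // (opE _ _ _ (f ∘ h)) ?compmA -?compmA ?hx ?hy.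
- move=> A B f x y; have [h [[hx hy] _]] := ab A x y.
  by rewrite (addE _ _ _ h) // (addE _ _ _ (f ∘ h)) ?compmA -?compmA ?hx ?hy.
- move=> A x; rewrite (opE _ _ _ (x ∘ nabla)) -?compmA ?ni ?nj ?compm1 //.
  by rewrite nk comp_zero.
- move=> A x y; have [h [[hx hy] _]] := ij A x y.
  by rewrite (opE _ _ _ h) // (addE _ _ _ (h ∘ c)) -?compmA ?ca ?cb ?ct.
Qed.

Lemma sub_add0 (P : C) (S : subtraction P) (A : C) (x : hom P A) :
  sub_add (zero hC (sub_dom S) A) x = x.
Proof. by rewrite -(sub_self S x) sub_addK. Qed.

(** The Mal'tsev operation of a group is [x - y + z]. *)
Definition maltsev (P : C) (S : subtraction P) (A : C) (x y z : hom P A) :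
  hom P A := sub_add (sub_op S x y) z.

Lemma maltsev_left (P : C) (S : subtraction P) (A : C) (x z : hom P A) :
  maltsev S x x z = z.
Proof. by rewrite /maltsev sub_self sub_add0. Qed.

Lemma maltsev_right (P : C) (S : subtraction P) (A : C) (x y : hom P A) :
  maltsev S x y y = x.
Proof. by rewrite /maltsev sub_addK. Qed.

Lemma maltsevN (P : C) (S : subtraction P) (A B : C) (f : hom A B) x y z :
  f ∘ maltsev S x y z = maltsev S (f ∘ x) (f ∘ y) (f ∘ z).
Proof. by rewrite /maltsev sub_addN sub_opN. Qed.

(** ** Quotients by reflexive graphs *)

(** By the Mal'tsev operation, the relation which a reflexive graph [u, v]
    defines on elements is an equivalence relation, hence by exactness the
    kernel pair of a map. The coequalizer of [u] and [v] then identifies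
    precisely the related elements. *)
Lemma reflexive_quotient (R X : C) (u v : hom R X) (e : hom X R) :
  u ∘ e = idm X -> v ∘ e = idm X ->
  exists (Q : C) (q : hom X Q), is_coequalizer q u v /\
    forall P (x y : hom P X), projective P -> q ∘ x = q ∘ y ->
      exists r, u ∘ r = x /\ v ∘ r = y.
Proof.
move=> ue ve.
have [XX [p1 [p2 [pm pe]]]] := binary_product limC X X.
have [uv [uvu uvv]] := pe R u v.
have [I [m [c [mm ce uvE]]]] := image_factorization uv.
pose r1 := p1 ∘ m; pose r2 := p2 ∘ m.
have r1c : r1 ∘ c = u by rewrite -compmA -uvE.
have r2c : r2 ∘ c = v by rewrite -compmA -uvE.
have rm T (a b : hom T I) : r1 ∘ a = r1 ∘ b -> r2 ∘ a = r2 ∘ b -> a = b.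
  by rewrite /r1 /r2 -!compmA => e1 e2; apply: mm; exact: pm.
have lift T (a b : hom T X) :
    (forall P (t : hom P T), projective P ->
       exists s, r1 ∘ s = a ∘ t /\ r2 ∘ s = b ∘ t) ->
    exists h, r1 ∘ h = a /\ r2 ∘ h = b.
  move=> ex; have [ab [abl abr]] := pe T a b.
  have [|h hab] := @element_factor I XX T m ab mm.
    move=> P t pP; have [s [s1 s2]] := ex P t pP; exists s.
    by apply: pm; rewrite !compmA ?s1 ?s2 ?abl ?abr.
  by exists h; rewrite /r1 /r2 -!compmA hab.
clearbody r1 r2.
have eqR : equivalence_relation r1 r2.
  split=> //.
  - by exists (c ∘ e); rewrite !compmA r1c r2c.
  - have [|s ?] := lift I r2 r1; last by exists s.
    move=> P t pP; have [S _] := subtraction_exists pP.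
    exists (maltsev S (c ∘ (e ∘ (r1 ∘ t))) t (c ∘ (e ∘ (r2 ∘ t)))).
    rewrite !maltsevN !(compmA r1) !(compmA r2) r1c r2c !(compmA u) !(compmA v).
    by rewrite ue ve !comp1m maltsev_left maltsev_right.
  - move=> P p q [rpq _]; apply: lift => P' t pP'.
    have [S _] := subtraction_exists pP'.
    exists (maltsev S (p ∘ t) (c ∘ (e ∘ (r2 ∘ (p ∘ t)))) (q ∘ t)).
    rewrite !maltsevN !(compmA r1 c) !(compmA r2 c) r1c r2c !(compmA u) !(compmA v).
    rewrite ue ve !comp1m (compmA r2 p) (compmA r1 q) rpq maltsev_left.
    by rewrite maltsev_right !compmA.
have [Y [f fk]] := exact_effective (semi_abelian_exact hC) eqR.
have [Q [q [qr qu]]] := regular_coeq regC fk.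
exists Q, q; split.
  split; first by rewrite -r1c -r2c !(compmA q) qr.
  move=> T a auv; apply: qu; apply: (regular_epi_epi ce).
  by rewrite -!compmA r1c r2c.
move=> P x y pP qxy.
have [f' [fq _]] := qu _ f fk.1.
have [|h [[h1 h2] _]] := fk.2 P x y; first by rewrite -fq -!compmA qxy.
have [r cr] := pP _ _ c ce h; exists r.
by rewrite -r1c -r2c -(compmA r1) -(compmA r2) cr.
Qed.

Lemma coequalizer_exists (X Y : C) (u v : hom X Y) :
  exists (Q : C) (q : hom Y Q), is_coequalizer q u v.
Proof.
have [S [i [j ij]]] := semi_abelian_coproducts hC X Y.
have [u' [[ui uj] _]] := ij Y u (idm Y).
have [v' [[vi vj] _]] := ij Y v (idm Y).
have [Q [q [[quv qu] _]]] := reflexive_quotient uj vj.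
exists Q, q; split; first by rewrite -ui -vi !compmA quv.
move=> T a auv; apply: qu.
have [h [_ hu]] := ij T (a ∘ u) a.
transitivity h; last by apply: hu; rewrite -!(compmA a) vi vj compm1.
by symmetry; apply: hu; rewrite -!(compmA a) ui uj compm1.
Qed.

(** ** Finite coproducts *)

(** Supplying an inclusion for every index, with no constraint outside of the
    list [s], avoids families indexed by the elements of a list. *)
Definition list_coproduct (I : eqType) (F : I -> C) (s : seq I) (S : C)
    (c : forall i, hom (F i) S) : Prop :=
  (forall T (a : forall i, hom (F i) T),
     exists h : hom S T, forall i, i \in s -> h ∘ c i = a i) /\
  (forall T (h h' : hom S T),
     (forall i, i \in s -> h ∘ c i = h' ∘ c i) -> h = h').

Lemma list_coproduct_exists (I : eqType) (F : I -> C) (s : seq I) :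
  exists (S : C) (c : forall i, hom (F i) S), list_coproduct s c.
Proof.
elim: s => [|x s [S [c [cex cu]]]].
  exists (zero_ob hC), (fun i => zero hC _ _); split=> [T a|T h h' _].
    by exists (zero hC _ _).
  by have [_ ->] := zero_object_maps (idm _) (idm _) h h' (zero_obP hC).
case: (boolP (x \in s)) => xs.
  exists S, c; split=> [T a|T h h' hh].
    have [h ha] := cex T a; exists h => i; rewrite inE.
    by case: eqP => [-> _|_ /= ]; apply: ha.
  by apply: cu => i si; apply: hh; rewrite inE si orbT.
have [S' [i [j ij]]] := semi_abelian_coproducts hC (F x) S.
pose c' y : hom (F y) S' := match x =P y with
  | ReflectT e => match e in _ = y return hom (F y) S' with erefl => i end
  | ReflectF _ => j ∘ c y
  end.
have c'x : c' x = i.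
  rewrite /c'; case: eqP => [e|//]; by rewrite (Prop_irrelevance e erefl).
have c'y y : y \in s -> c' y = j ∘ c y.
  by move=> ys; rewrite /c'; case: eqP => // e; case/negP: xs; rewrite e.
exists S', c'; split=> [T a|T h h' hh].
  have [b ba] := cex T a; have [h [[hi hj] _]] := ij T (a x) b.
  exists h => y; rewrite inE => /orP[/eqP->|ys]; first by rewrite c'x.
  by rewrite c'y // compmA hj ba.
have [k [_ ku]] := ij T (h' ∘ i) (h' ∘ j).
rewrite -(ku h'); last by split.
rewrite -(ku h) //; split.
  by rewrite -c'x hh // inE eqxx.
by apply: cu => y ys; rewrite -!compmA -c'y // hh // inE ys orbT.
Qed.

Lemma finite_colimits : has_finite_colimits C.
Proof.
move=> J F [fJ fh].
have [s sP] : exists s : seq {classic J}, forall j, j \in s.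
  have /finite_seqP[s sE] : finite_set [set: {classic J}] by exact: fJ.
  by exists s => j; have : [set` s]%classic j by rewrite -sE.
pose A := {classic {i : J & {j : J & hom i j}}}.
have [t tP] : exists t : seq A, forall a, a \in t.
  have hs (i j : J) : exists l : seq {classic hom i j}, forall u, u \in l.
    have /finite_seqP[l lE] : finite_set [set: {classic hom i j}] by exact: fh.
    by exists l => u; have : [set` l]%classic u by rewrite -lE.
  exists (flatten [seq flatten [seq [seq (existT _ i (existT _ j u) : A)
     | u <- projT1 (cid (hs i j))] | j <- s] | i <- s]).
  case=> i [j u]; apply/flattenP; eexists; first exact: (map_f _ (sP i)).
  apply/flattenP; eexists; first exact: (map_f _ (sP j)).
  by apply/(@mapP {classic hom i j} A); exists u => //; case: cid.
have [S [c [cex cu]]] := list_coproduct_exists (F : {classic J} -> C) s.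
have [R [r [rex ru]]] := list_coproduct_exists
  (fun a : A => F (projT1 a)) t.
have [u uP] := rex S (fun a => c (projT1 a)).
have [v vP] := rex S (fun a => c (projT1 (projT2 a)) ∘ fmap F (projT2 (projT2 a))).
have [L [q [quv qu]]] := coequalizer_exists u v.
exists L, (fun j => q ∘ c j); split=> [i j w|X p pc].
  have /= uw := uP (existT _ i (existT _ j w)) (tP _).
  have /= vw := vP (existT _ i (existT _ j w)) (tP _).
  by rewrite -uw -compmA -vw !compmA quv.
have [h hp] := cex X p.
have [|k [kq ku]] := qu X h.
  apply: ru => a at_; rewrite -!compmA uP // vP // compmA !hp //.
exists k; split=> [j|k' kp]; first by rewrite compmA kq hp.
by apply: ku; apply: cu => j js; rewrite -compmA kp hp.
Qed.

End Elements.

(** * Degreewise limits and colimits of simplicial objects *)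

Section GraphColimits.
Variables (I E : Type) (src tgt : E -> I).

(** A directed graph as indexing shape covers the diagrams indexed by a category
    as well as the sequences. *)
Definition graph_cocone (D : category) (F : I -> D)
    (f : forall e, hom (F (src e)) (F (tgt e))) X (q : forall i, hom (F i) X) :=
  forall e, q (tgt e) ∘ f e = q (src e).

Definition graph_colimit (D : category) (F : I -> D)
    (f : forall e, hom (F (src e)) (F (tgt e))) L (p : forall i, hom (F i) L) :=
  graph_cocone f p /\
  forall X (q : forall i, hom (F i) X), graph_cocone f q ->
    exists! h : hom L X, forall i, h ∘ p i = q i.

Variables (C : category) (F : I -> simplicial C).
Variable f : forall e, hom (F (src e)) (F (tgt e)).

Lemma simplicial_colimit :
  (forall m, exists (L : C) (p : forall i, hom (sob (F i) m) L),
     graph_colimit (fun e => smap (f e) m) p) ->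
  exists (L : simplicial C) (p : forall i, hom (F i) L), graph_colimit f p /\
    forall m, graph_colimit (fun e => smap (f e) m) (fun i => smap (p i) m).
Proof.
move=> ex; pose L m := projT1 (cid (ex m)).
pose p m : forall i, hom (sob (F i) m) (L m) := projT1 (cid (projT2 (cid (ex m)))).
have pP m : graph_colimit (fun e => smap (f e) m) (p m).
  exact: (projT2 (cid (projT2 (cid (ex m))))).
clearbody p; clearbody L.
have pu m X (h h' : hom (L m) X) : (forall i, h ∘ p m i = h' ∘ p m i) -> h = h'.
  move=> hh; have [|k [_ ku]] := (pP m).2 X (fun i => h ∘ p m i).
    by move=> e; rewrite -compmA (pP m).1.
  by rewrite -(ku h) // -(ku h').
have Lex m n (u : @hom (op simplex_category) m n) :
    exists h : hom (L m) (L n), forall i, h ∘ p m i = p n i ∘ fmap (F i) u.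
  have [|h [hp _]] := (pP m).2 (L n) (fun i => p n i ∘ fmap (F i) u).
    by move=> e; rewrite -compmA -(ncompP (f e)) compmA (pP n).1.
  by exists h.
pose Lmap m n u := projT1 (cid (Lex m n u)).
have LmapP m n u i : Lmap m n u ∘ p m i = p n i ∘ fmap (F i) u.
  exact: (projT2 (cid (Lex m n u))).
clearbody Lmap.
have Lmap1 m : Lmap m m (idm _) = idm _.
  by apply: pu => i; rewrite LmapP fmap1 comp1m compm1.
have LmapM m n k (v : @hom (op simplex_category) n k) u :
    Lmap m k (v ∘ u) = Lmap n k v ∘ Lmap m n u.
  apply: pu => i; rewrite LmapP -(compmA (Lmap n k v)) LmapP.
  by rewrite fmapM compmA -LmapP compmA.
pose LF : simplicial C := @Functor (op simplex_category) C L Lmap Lmap1 LmapM.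
pose pn i : @hom (simplicial C) (F i) LF :=
  @NatTrans _ _ (F i) LF (fun m => p m i) (fun m n u => esym (LmapP m n u i)).
exists LF, pn; split => //; split.
  by move=> e; apply: nattransP => m; exact: (pP m).1.
move=> X q qc.
have hex m : exists h : hom (L m) (sob X m), forall i, h ∘ p m i = smap (q i) m.
  have [|h [hp _]] := (pP m).2 (sob X m) (fun i => smap (q i) m).
    by move=> e; rewrite -(qc e).
  by exists h.
pose h m := projT1 (cid (hex m)).
have hP m i : h m ∘ p m i = smap (q i) m by exact: (projT2 (cid (hex m))).
clearbody h.
have hn m n u : h n ∘ Lmap m n u = fmap X u ∘ h m.
  apply: pu => i; rewrite -compmA LmapP -compmA hP compmA hP.
  exact: (ncompP (q i)).
exists (@NatTrans _ _ LF X h hn); split=> [i|h' h'q].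
  by apply: nattransP => m; exact: hP.
apply: nattransP => m; apply: pu => i /=; rewrite hP.
by rewrite -(h'q i).
Qed.

End GraphColimits.

Section Levelwise.
Variable C : category.

Definition level_functor (J : category) (F : functor J (simplicial C)) (m : nat) :
    functor J C :=
  @Functor J C (fun j => sob (F j) m) (fun i j u => smap (fmap F u) m)
    (fun i => congr1 (fun g => smap g m) (fmap1 F i))
    (fun i j k v u => congr1 (fun g => smap g m) (fmapM F v u)).

Lemma simplicial_finite_colimits :
  has_finite_colimits C -> has_finite_colimits (simplicial C).
Proof.
move=> colC J F fJ.
pose E := {i : J & {j : J & hom i j}}.
have eqc (D : category) (G : functor J D) X (q : forall j, hom (G j) X) :
    is_cocone q <-> @graph_cocone J E (fun e => projT1 e)
      (fun e => projT1 (projT2 e)) D G (fun e => fmap G (projT2 (projT2 e))) X q.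
  split=> [qc [i [j u]]|qc i j u]; first exact: qc.
  exact: (qc (existT _ i (existT _ j u))).
have [|L [p [[pc pu] _]]] := @simplicial_colimit J E (fun e => projT1 e)
  (fun e => projT1 (projT2 e)) C F (fun e => fmap F (projT2 (projT2 e))).
  move=> m; have [L [p [pc pu]]] := colC J (level_functor F m) fJ.
  exists L, p; split; first by case=> i [j u]; exact: pc.
  move=> X q qc; apply: pu => i j u.
  exact: (qc (existT _ i (existT _ j u))).
exists L, p; split; first exact/eqc.
by move=> X q /eqc; exact: pu.
Qed.

Lemma simplicial_finite_limits :
  has_finite_limits C -> has_finite_limits (simplicial C).
Proof.
move=> limC J F fJ.
have ex m := limC J (level_functor F m) fJ.
pose L m := projT1 (cid (ex m)).
pose p m : forall i, hom (L m) (sob (F i) m) := projT1 (cid (projT2 (cid (ex m)))).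
have pP m : is_limit (F := level_functor F m) (p m).
  exact: (projT2 (cid (projT2 (cid (ex m))))).
clearbody p; clearbody L.
have pu m X (h h' : hom X (L m)) : (forall i, p m i ∘ h = p m i ∘ h') -> h = h'.
  move=> hh; have [|k [_ ku]] := (pP m).2 X (fun i => p m i ∘ h).
    by move=> i j u; rewrite compmA (pP m).1.
  by rewrite -(ku h) // -(ku h') // => i; exact: esym (hh i).
have Lex m n (u : @hom (op simplex_category) m n) :
    exists h : hom (L m) (L n), forall i, p n i ∘ h = fmap (F i) u ∘ p m i.
  have [|h [hp _]] := (pP n).2 (L m) (fun i => fmap (F i) u ∘ p m i).
    move=> i j v; rewrite compmA [X in X ∘ _](ncompP (fmap F v)).
    by rewrite -compmA; congr (_ ∘ _); exact: (pP m).1.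
  by exists h.
pose Lmap m n u := projT1 (cid (Lex m n u)).
have LmapP m n u i : p n i ∘ Lmap m n u = fmap (F i) u ∘ p m i.
  exact: (projT2 (cid (Lex m n u))).
clearbody Lmap.
have Lmap1 m : Lmap m m (idm _) = idm _.
  by apply: pu => i; rewrite LmapP fmap1 comp1m compm1.
have LmapM m n k (v : @hom (op simplex_category) n k) u :
    Lmap m k (v ∘ u) = Lmap n k v ∘ Lmap m n u.
  apply: pu => i; rewrite LmapP compmA LmapP.
  by rewrite fmapM -compmA -LmapP compmA.
pose LF : simplicial C := @Functor (op simplex_category) C L Lmap Lmap1 LmapM.
pose pn i : @hom (simplicial C) LF (F i) :=
  @NatTrans _ _ LF (F i) (fun m => p m i) (fun m n u => LmapP m n u i).
exists LF, pn; split.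
  by move=> i j u; apply: nattransP => m; exact: (pP m).1.
move=> X q qc.
have hex m : exists h : hom (sob X m) (L m), forall i, p m i ∘ h = smap (q i) m.
  have [|h [hp _]] := (pP m).2 (sob X m) (fun i => smap (q i) m).
    by move=> i j u; rewrite -(qc _ _ u).
  by exists h.
pose h m := projT1 (cid (hex m)).
have hP m i : p m i ∘ h m = smap (q i) m by exact: (projT2 (cid (hex m))).
clearbody h.
have hn m n u : h n ∘ fmap X u = Lmap m n u ∘ h m.
  apply: pu => i; rewrite compmA hP compmA LmapP -compmA hP.
  exact: (ncompP (q i)).
exists (@NatTrans _ _ X LF h hn); split=> [i|h' h'q].
  by apply: nattransP => m; exact: hP.
apply: nattransP => m; apply: pu => i /=; rewrite hP.
by rewrite -(h'q i).
Qed.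

(** ** Eventually constant sequences *)

Lemma constant_chain_colimit (X : nat -> C) (i : forall k, hom (X k) (X k.+1)) :
  (forall k, is_iso (i k)) -> exists (L : C) (j : forall k, hom (X k) L),
    @graph_colimit nat nat id S C X i L j /\ forall k, is_iso (j k).
Proof.
move=> ii; pose i' k := projT1 (cid (ii k)).
have [i'i ii'] : (forall k, i' k ∘ i k = idm _) /\ (forall k, i k ∘ i' k = idm _).
  by split=> k; rewrite /i'; case: (cid (ii k)) => /= ? [].
clearbody i'.
pose j := nat_rect (fun k => hom (X k) (X 0)) (idm _) (fun k jk => jk ∘ i' k).
have jS k : j k.+1 ∘ i k = j k by rewrite /= -compmA i'i compm1.
have ji k : is_iso (j k).
  elim: k => [|k IH]; first exact: is_iso_idm.
  by apply: is_iso_comp => //; exists (i k).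
exists (X 0), j; split => //; split => // T q qc.
exists (q 0); split=> [k|h hj]; last by rewrite -(hj 0) compm1.
elim: k => [|k IH] /=; first by rewrite compm1.
by rewrite compmA IH -(qc k) -compmA ii' compm1.
Qed.

Lemma eventually_constant_chain_colimit (N : nat) (X : nat -> C)
    (i : forall k, hom (X k) (X k.+1)) :
  (forall k, N <= k -> is_iso (i k)) -> exists (L : C) (j : forall k, hom (X k) L),
    @graph_colimit nat nat id S C X i L j /\ forall k, N <= k -> is_iso (j k).
Proof.
elim: N X i => [|N IH] X i ii.
  have [|L [j [jc ji]]] := @constant_chain_colimit X i; first by move=> k; exact: ii.
  by exists L, j.
have [|L [j [[jc ju] ji]]] := IH (fun k => X k.+1) (fun k => i k.+1).
  by move=> k Nk; exact: ii.
pose j' k : hom (X k) L := match k with 0 => j 0 ∘ i 0 | k'.+1 => j k' end.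
exists L, j'; split; last by case.
split=> [[|k] //|T q qc].
have [|h [hj hu]] := ju T (fun k => q k.+1); first by move=> k; exact: qc.
exists h; split=> [[|k]|h' h'j]; rewrite /= ?compmA ?hj //.
by apply: hu => k; rewrite -(h'j k.+1).
Qed.

Lemma graph_colimit_endo (I E : Type) (src tgt : E -> I) (F : I -> C)
    (f : forall e, hom (F (src e)) (F (tgt e))) L (p : forall i, hom (F i) L)
    (h : hom L L) :
  graph_colimit f p -> (forall i, h ∘ p i = p i) -> h = idm L.
Proof.
move=> [pc pu] hp; have [k [_ ku]] := pu L p pc.
by rewrite -(ku h) // -(ku (idm L)) // => i; rewrite comp1m.
Qed.

(** [C] may lack countable colimits, but here each degree of the colimit is
    a term of the sequence. *)
Lemma simplicial_chain_colimit (X : nat -> simplicial C)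
    (i : forall k, hom (X k) (X k.+1)) :
  (forall k m, m <= k -> is_iso (smap (i k) m)) ->
  exists (L : simplicial C) (j : forall k, hom (X k) L),
    @graph_colimit nat nat id S _ X i L j /\
    forall k m, m <= k -> is_iso (smap (j k) m).
Proof.
move=> ii.
have ex m := @eventually_constant_chain_colimit m _ (fun k => smap (i k) m)
  (fun k mk => ii k m mk).
have [|L [j [jL jm]]] := @simplicial_colimit nat nat id S C X i.
  by move=> m; have [L [j [jc _]]] := ex m; exists L, j.
exists L, j; split => // k m mk.
have [L' [j' [jc' ji']]] := ex m.
have [a [aj _]] := (jm m).2 L' _ jc'.1.
have [b [bj _]] := jc'.2 _ _ (jm m).1.
rewrite -(bj k); apply: is_iso_comp; last exact: ji'.
exists a; split.
  by apply: (graph_colimit_endo jc') => l; rewrite -compmA bj aj.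
by apply: (graph_colimit_endo (jm m)) => l; rewrite -compmA aj bj.
Qed.

End Levelwise.

(** * Simplicial operators as functions on natural numbers *)

Definition simplex_ffun m n (g : nat -> nat) : {ffun 'I_m.+1 -> 'I_n.+1} :=
  [ffun i : 'I_m.+1 => inord (g i)].

Lemma monotone_const m n : monotone (simplex_ffun m n (fun _ => 0)).
Proof. by apply/forallP=> i; apply/forallP=> j; rewrite !ffunE leqnn implybT. Qed.

(** Operators are given by arbitrary functions on [nat], so that the simplicial
    identities become linear arithmetic. Functions which are not monotone yield a
    constant, as a value is needed for them too. *)
Definition simplex_map m n (g : nat -> nat) : simplex_hom m n :=
  if @idP (monotone (simplex_ffun m n g)) is ReflectT gP then SimplexHom gP
  else SimplexHom (monotone_const m n).

Definition simplex_fun m n (u : simplex_hom m n) (i : nat) : nat :=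
  val u (inord i).

Definition nondecreasing m n (g : nat -> nat) : Prop :=
  (forall i, i <= m -> g i <= n) /\ (forall i j, i <= j -> j <= m -> g i <= g j).

Lemma simplex_mapE m n g (i : 'I_m.+1) : nondecreasing m n g ->
  val (simplex_map m n g) i = g i :> nat.
Proof.
move=> [gn gm]; have vE (j : 'I_m.+1) : simplex_ffun m n g j = g j :> nat.
  by rewrite ffunE inordK // ltnS gn // -ltnS.
have gP : monotone (simplex_ffun m n g).
  apply/forallP => j; apply/forallP => k; apply/implyP => jk.
  by rewrite !vE gm // -ltnS.
by rewrite /simplex_map; case: {-}_ / idP => [p|/(_ gP)] //; rewrite -vE.
Qed.

Lemma simplex_hom_ext m n (u v : simplex_hom m n) :
  (forall i, i <= m -> simplex_fun u i = simplex_fun v i) -> u = v.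
Proof.
move=> uv; apply: val_inj; apply/ffunP => i; apply: val_inj.
by have := uv i; rewrite /simplex_fun inord_val -ltnS; apply.
Qed.

Lemma simplex_fun_nondecreasing m n (u : simplex_hom m n) :
  nondecreasing m n (simplex_fun u).
Proof.
split=> [i im|i j ij jm]; first by rewrite /simplex_fun -ltnS.
have im : i <= m by exact: leq_trans ij jm.
apply: (implyP (forallP (forallP (valP u) _) _)).
by rewrite !inordK.
Qed.

Lemma simplex_funE m n g i : nondecreasing m n g -> i <= m ->
  simplex_fun (simplex_map m n g) i = g i.
Proof. by move=> gP im; rewrite /simplex_fun simplex_mapE // inordK. Qed.

Lemma eq_simplex_map m n g h : (forall i, i <= m -> g i = h i) ->
  simplex_map m n g = simplex_map m n h.
Proof.
move=> gh; rewrite /simplex_map.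
have -> // : simplex_ffun m n g = simplex_ffun m n h.
by apply/ffunP => i; rewrite !ffunE gh // -ltnS.
Qed.

Lemma simplex_funK m n (u : simplex_hom m n) :
  simplex_map m n (simplex_fun u) = u.
Proof.
apply: simplex_hom_ext => i im; rewrite simplex_funE //.
exact: simplex_fun_nondecreasing.
Qed.

Lemma simplex_fun_comp m n p (v : @hom simplex_category n p)
    (u : @hom simplex_category m n) i :
  simplex_fun (v ∘ u) i = simplex_fun v (simplex_fun u i).
Proof. by rewrite /simplex_fun /= ffunE inord_val. Qed.

Lemma simplex_fun_id m i : i <= m ->
  simplex_fun (@idm simplex_category m) i = i.
Proof. by move=> im; rewrite /simplex_fun /= ffunE inordK. Qed.

Lemma nondecreasing_comp m n p g h : nondecreasing m n g ->
  nondecreasing n p h -> nondecreasing m p (h \o g).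
Proof.
move=> [gn gm] [hn hm]; split=> [i im|i j ij jm] /=; first by rewrite hn ?gn.
by apply: hm; [exact: gm | exact: gn].
Qed.

Lemma nondecreasing_bump n i : nondecreasing n n.+1 (bump i).
Proof. by split=> *; rewrite /bump; lia. Qed.

Lemma nondecreasing_unbump n i : i <= n -> nondecreasing n.+1 n (unbump i).
Proof. by move=> ?; split=> *; rewrite /unbump; lia. Qed.

Section Operators.
Variable C : category.
Implicit Types A B : simplicial C.

Definition act A m n (g : nat -> nat) : hom (sob A n) (sob A m) :=
  @fmap _ _ A n m (simplex_map m n g).

Lemma act_fmap A m n (u : simplex_hom m n) :
  @fmap _ _ A n m u = act A m n (simplex_fun u).
Proof. by rewrite /act simplex_funK. Qed.

Lemma eq_act A m n g h : (forall i, i <= m -> g i = h i) ->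
  act A m n g = act A m n h.
Proof. by move=> gh; rewrite /act (eq_simplex_map n gh). Qed.

Lemma act_comp A m n p g h : nondecreasing m n g -> nondecreasing n p h ->
  act A m n g ∘ act A n p h = act A m p (h \o g).
Proof.
move=> gP hP; rewrite /act -fmapM; congr (fmap _ _).
apply: simplex_hom_ext => i im.
have ghP := nondecreasing_comp gP hP; case: (gP) => gn _.
by rewrite simplex_fun_comp (simplex_funE gP) // (simplex_funE hP) ?gn // simplex_funE.
Qed.

Lemma act_id A m g : (forall i, i <= m -> g i = i) -> act A m m g = idm _.
Proof.
move=> gi; rewrite (@eq_act A m m g id) // -(fmap1 A); congr (fmap _ _).
apply: simplex_hom_ext => i im; rewrite simplex_funE // ?simplex_fun_id //.
Qed.

Lemma act_smap A B (f : hom A B) m n g :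
  smap f m ∘ act A m n g = act B m n g ∘ smap f n.
Proof. exact: (ncompP f). Qed.

Definition dface A n i : hom (sob A n.+1) (sob A n) := act A n n.+1 (bump i).
Definition degen A n i : hom (sob A n) (sob A n.+1) := act A n.+1 n (unbump i).

Lemma faceE A n (i : 'I_n.+2) : face A i = dface A n i.
Proof.
rewrite /face /dface /act; congr (fmap _ _); apply: simplex_hom_ext => j jn.
rewrite simplex_funE //; last exact: nondecreasing_bump.
by rewrite /simplex_fun /= ffunE /= inordK.
Qed.

Lemma dface_inord A n i : i <= n.+1 -> face A (inord i : 'I_n.+2) = dface A n i.
Proof. by move=> ni; rewrite faceE inordK. Qed.

Lemma dface_smap A B (f : hom A B) n i :
  smap f n ∘ dface A n i = dface B n i ∘ smap f n.+1.
Proof. exact: act_smap. Qed.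

Lemma degen_smap A B (f : hom A B) n i :
  smap f n.+1 ∘ degen A n i = degen B n i ∘ smap f n.
Proof. exact: act_smap. Qed.

Ltac act_normalize :=
  rewrite /dface /degen !act_comp; try exact: nondecreasing_bump;
  try (apply: nondecreasing_unbump; lia).

Lemma dface_dface A n i j : i < j ->
  dface A n i ∘ dface A n.+1 j = dface A n j.-1 ∘ dface A n.+1 i.
Proof.
move=> ij; act_normalize; apply: eq_act => k _ /=.
by rewrite /bump; lia.
Qed.

Lemma dface_degen_id A n i j : i <= n -> (j == i) || (j == i.+1) ->
  dface A n j ∘ degen A n i = idm _.
Proof.
move=> ni ji; act_normalize; apply: act_id => k _ /=.
by rewrite /bump /unbump; lia.
Qed.

Lemma dface_degen_lt A n i j : i < j -> j <= n.+1 ->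
  dface A n.+1 i ∘ degen A n.+1 j = degen A n j.-1 ∘ dface A n i.
Proof.
move=> ij jn; act_normalize; apply: eq_act => k _ /=.
by rewrite /bump /unbump; lia.
Qed.

Lemma dface_degen_gt A n i j : j.+1 < i -> i <= n.+2 ->
  dface A n.+1 i ∘ degen A n.+1 j = degen A n j ∘ dface A n i.-1.
Proof.
move=> ij jn; act_normalize; apply: eq_act => k _ /=.
by rewrite /bump /unbump; lia.
Qed.

End Operators.

(** * Cycles, horns and fibrations in terms of elements *)

Section Cycles.
Variables (C : category) (hC : semi_abelian C) (hP : enough_projectives C).
Implicit Types A B : simplicial C.
Local Notation null := (zero hC _ _).

Lemma dface_dface_elt A n i j T (x : hom T (sob A n.+2)) : i < j ->
  dface A n i ∘ (dface A n.+1 j ∘ x) = dface A n j.-1 ∘ (dface A n.+1 i ∘ x).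
Proof. by move=> ij; rewrite !compmA dface_dface. Qed.

Lemma dface_degen_id_elt A n i j T (x : hom T (sob A n)) : i <= n ->
  (j == i) || (j == i.+1) -> dface A n j ∘ (degen A n i ∘ x) = x.
Proof. by move=> ni ji; rewrite compmA dface_degen_id // comp1m. Qed.

Lemma dface_degen_lt_elt A n i j T (x : hom T (sob A n.+1)) :
  i < j -> j <= n.+1 -> dface A n.+1 i ∘ (degen A n.+1 j ∘ x) =
    degen A n j.-1 ∘ (dface A n i ∘ x).
Proof. by move=> ij jn; rewrite !compmA dface_degen_lt. Qed.

Lemma dface_degen_gt_elt A n i j T (x : hom T (sob A n.+1)) :
  j.+1 < i -> i <= n.+2 -> dface A n.+1 i ∘ (degen A n.+1 j ∘ x) =
    degen A n j ∘ (dface A n i.-1 ∘ x).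
Proof. by move=> ij jn; rewrite !compmA dface_degen_gt. Qed.

Lemma dface_smap_elt A B (f : hom A B) n i T (x : hom T (sob A n.+1)) :
  dface B n i ∘ (smap f n.+1 ∘ x) = smap f n ∘ (dface A n i ∘ x).
Proof. by rewrite !compmA dface_smap. Qed.

(** There are no faces in degree 0: every element of degree 0 counts as a
    cycle. *)
Definition face_null A n i T : hom T (sob A n) -> Prop :=
  match n return hom T (sob A n) -> Prop with
  | 0 => fun _ => True
  | m.+1 => fun x => dface A m i ∘ x = null
  end.

Definition normal A n T (x : hom T (sob A n)) : Prop :=
  forall i, i < n -> face_null i x.

Definition cycle A n T (x : hom T (sob A n)) : Prop :=
  forall i, i <= n -> face_null i x.

Lemma face_null_comp A n i T U (x : hom T (sob A n)) (t : hom U T) :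
  face_null i x -> face_null i (x ∘ t).
Proof. by case: n x => //= n x x0; rewrite compmA x0 zero_comp. Qed.

Lemma face_null_smap A B (f : hom A B) n i T (x : hom T (sob A n)) :
  face_null i x -> face_null i (smap f n ∘ x).
Proof. by case: n x => //= n x x0; rewrite dface_smap_elt x0 comp_zero. Qed.

Lemma cycle_comp A n T U (x : hom T (sob A n)) (t : hom U T) :
  cycle x -> cycle (x ∘ t).
Proof. by move=> xc i ni; apply: face_null_comp; exact: xc. Qed.

Lemma cycle_smap A B (f : hom A B) n T (x : hom T (sob A n)) :
  cycle x -> cycle (smap f n ∘ x).
Proof. by move=> xc i ni; apply: face_null_smap; exact: xc. Qed.

Lemma cycle_null A n T : cycle (zero hC T (sob A n)).
Proof. by case: n => //= n i _; exact: comp_zero. Qed.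

Lemma cycle_normal A n T (x : hom T (sob A n)) : cycle x -> normal x.
Proof. by move=> xc i ni; apply: xc; exact: ltnW. Qed.

Lemma normal_smap A B (f : hom A B) n T (x : hom T (sob A n)) :
  normal x -> normal (smap f n ∘ x).
Proof. by move=> xc i ni; apply: face_null_smap; exact: xc. Qed.

Lemma cycle_last_face A n T (x : hom T (sob A n.+1)) :
  (forall i, i < n -> dface A n i ∘ x = null) ->
  cycle (dface A n n ∘ x) -> cycle (dface A n n.+1 ∘ x).
Proof.
case: n x => // n x x0 xc i ni /=.
rewrite dface_dface_elt ?ltnS //= .
case: (ltngtP i n.+1) ni => // [ni|->] _; first by rewrite x0 // comp_zero.
exact: (xc n.+1).
Qed.

Lemma normal_boundary_cycle A n T (x : hom T (sob A n.+1)) :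
  normal x -> cycle (dface A n n.+1 ∘ x).
Proof.
move=> x0; apply: cycle_last_face; first by move=> i ni; apply: x0; exact: ltnW.
by rewrite (x0 n) //; exact: cycle_null.
Qed.

Lemma dface_degen_cycle A n T (x : hom T (sob A n)) i j : cycle x ->
  j <= n -> i <= n.+1 -> i != j -> i != j.+1 ->
  dface A n i ∘ (degen A n j ∘ x) = null.
Proof.
case: n x => [x _|n x xc] jn ni ij ij1; first lia.
case: (ltngtP i j) ij => // ij _.
  by rewrite dface_degen_lt_elt // xc ?comp_zero //; lia.
by rewrite dface_degen_gt_elt ?xc ?comp_zero //; lia.
Qed.

(** ** Filling horns *)

Definition horn_compatible A n k T : (nat -> hom T (sob A n)) -> Prop :=
  match n return (nat -> hom T (sob A n)) -> Prop with
  | 0 => fun _ => True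
  | m.+1 => fun x => forall i j, i < j -> j <= m.+2 -> i != k -> j != k ->
      dface A m i ∘ x j = dface A m j.-1 ∘ x i
  end.

(** The Mal'tsev operation replaces a face [z] of [y] by a face [x], as
    [y - s z + s x] does in a simplicial group. Going up to [k] with [s_r], and
    then down to [k] with [s_(r-1)], the faces which were already correct remain
    so. *)
Lemma horn_filler A n k P (x : nat -> hom P (sob A n)) : projective P ->
  k <= n.+1 -> horn_compatible k x ->
  exists y, forall i, i <= n.+1 -> i != k -> dface A n i ∘ y = x i.
Proof.
move=> pP kn xh; have [S _] := subtraction_exists hC hP pP.
have up r : r <= k -> exists y, forall i, i < r -> dface A n i ∘ y = x i.
  elim: r => [|r IH] rk; first by exists null.
  have [y yx] := IH (ltnW rk).
  exists (maltsev S y (degen A n r ∘ (dface A n r ∘ y)) (degen A n r ∘ x r)).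
  move=> i; rewrite ltnS leq_eqVlt => /orP[/eqP->|ir].
    rewrite maltsevN !dface_degen_id_elt ?eqxx ?maltsev_left //; lia.
  rewrite maltsevN yx //; case: n A x kn xh y yx {IH} => [|n] A x kn xh y yx.
    lia.
  rewrite !dface_degen_lt_elt //; [|lia..].
  rewrite dface_dface_elt // yx // (xh i r) ?maltsev_right //; lia.
have down t : t <= n.+1 - k -> exists y, forall i, i <= n.+1 ->
    (i < k) || (n.+1 - t < i) -> dface A n i ∘ y = x i.
  elim: t => [|t IH] tk.
    have [y yx] := up k (leqnn k); exists y => i ni.
    case/orP => [|ti]; [exact: yx | lia].
  have [y yx] := IH (ltnW tk); pose r := n - t.
  exists (maltsev S y (degen A n r ∘ (dface A n r.+1 ∘ y)) (degen A n r ∘ x r.+1)).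
  move=> i ni ik; case: (i =P r.+1) => [->|/eqP ir].
    rewrite maltsevN !dface_degen_id_elt ?eqxx ?orbT ?maltsev_left //; lia.
  rewrite maltsevN yx //; last by lia.
  case: n A x kn xh y yx @r {IH up} tk ni ik ir => [|n] A x kn xh y yx r tk ni ik ir.
    lia.
  case: (ltngtP i r.+1) ir => // ir _.
    rewrite !dface_degen_lt_elt //; [|lia..].
    rewrite dface_dface_elt // yx ?(xh i r.+1) ?maltsev_right //; lia.
  rewrite !dface_degen_gt_elt //; [|lia..].
  by rewrite -dface_dface_elt // yx ?(xh r.+1 i) ?maltsev_right //; lia.
have [y yx] := down _ (leqnn _); exists y => i ni ik; apply: yx => //; lia.
Qed.

(** ** Homologous cycles *)

(** A homotopy relates cycles in this way for varying [j]. The position [j] is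
    immaterial, see [homologous_at_homologous], and [n] is the position at which
    the relation is equality of homology classes. *)
Definition homologous_at A n j T (x y : hom T (sob A n)) : Prop :=
  exists w : hom T (sob A n.+1), [/\ forall i, i <= n.+1 -> i != j ->
    i != j.+1 -> dface A n i ∘ w = null, dface A n j ∘ w = x
    & dface A n j.+1 ∘ w = y].

Definition homologous A n T (x y : hom T (sob A n)) : Prop :=
  exists w : hom T (sob A n.+1), [/\ forall i, i < n -> dface A n i ∘ w = null,
    dface A n n ∘ w = x & dface A n n.+1 ∘ w = y].

Lemma homologous_atn A n T (x y : hom T (sob A n)) :
  homologous_at n x y <-> homologous x y.
Proof.
split=> -[w [w0 wx wy]]; exists w; split=> // i ni; first by apply: w0; lia.
by move=> *; apply: w0; lia.
Qed.

Lemma homologous_refl A n T (x : hom T (sob A n)) : cycle x -> homologous x x.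
Proof.
move=> xc; exists (degen A n n ∘ x); rewrite !dface_degen_id_elt ?eqxx ?orbT //.
split=> // i ni; apply: dface_degen_cycle => //; lia.
Qed.

Lemma homologous_smap A B (f : hom A B) n T (x y : hom T (sob A n)) :
  homologous x y -> homologous (smap f n ∘ x) (smap f n ∘ y).
Proof.
move=> [w [w0 wx wy]]; exists (smap f n.+1 ∘ w).
rewrite !dface_smap_elt wx wy; split=> // i ni.
by rewrite dface_smap_elt w0 // comp_zero.
Qed.

Lemma homologous_sym A n P (x y : hom P (sob A n)) : projective P ->
  cycle x -> cycle y -> homologous x y -> homologous y x.
Proof.
move=> pP xc yc [w [w0 wx wy]]; have [S _] := subtraction_exists hC hP pP.
exists (maltsev S (degen A n n ∘ x) w (degen A n n ∘ y)).
split=> [i ni||]; rewrite maltsevN.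
- by rewrite !dface_degen_cycle ?w0 ?maltsev_left //; lia.
- by rewrite !dface_degen_id_elt ?eqxx // wx maltsev_left.
- by rewrite !dface_degen_id_elt ?eqxx ?orbT // wy maltsev_right.
Qed.

Lemma homologous_trans A n P (x y z : hom P (sob A n)) : projective P ->
  cycle y -> homologous x y -> homologous y z -> homologous x z.
Proof.
move=> pP yc [w [w0 wx wy]] [v [v0 vy vz]].
have [S _] := subtraction_exists hC hP pP.
exists (maltsev S w (degen A n n ∘ y) v).
split=> [i ni||]; rewrite maltsevN.
- by rewrite !dface_degen_cycle ?w0 ?v0 ?maltsev_left //; lia.
- by rewrite !dface_degen_id_elt ?eqxx // wx vy maltsev_right.
- by rewrite !dface_degen_id_elt ?eqxx ?orbT // wy vz maltsev_left.
Qed.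

(** In a simplicial group, [s_j x - w + s_(j+1) y] has the faces of [w] moved by
    one position. *)
Lemma homologous_at_shift A n j P (x y : hom P (sob A n)) : projective P ->
  cycle x -> cycle y -> j < n -> homologous_at j x y -> homologous_at j.+1 x y.
Proof.
move=> pP xc yc jn [w [w0 wx wy]]; have [S _] := subtraction_exists hC hP pP.
exists (maltsev S (degen A n j ∘ x) w (degen A n j.+1 ∘ y)).
split=> [i ni ij ij2||]; rewrite maltsevN.
- rewrite (@dface_degen_cycle _ _ _ y) //; case: (i =P j) => [->|/eqP ij0].
    by rewrite dface_degen_id_elt ?eqxx ?wx ?maltsev_left //; lia.
  by rewrite dface_degen_cycle ?w0 ?maltsev_left //; lia.
- by rewrite !dface_degen_id_elt ?eqxx ?orbT ?wy ?maltsev_right //; lia.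
- rewrite dface_degen_cycle // ?w0 ?dface_degen_id_elt ?maltsev_left //; lia.
Qed.

Lemma homologous_at_homologous A n j P (x y : hom P (sob A n)) : projective P ->
  cycle x -> cycle y -> j <= n -> homologous_at j x y -> homologous x y.
Proof.
move=> pP xc yc jn; move: {2}(n - j) (erefl (n - j)) => t.
elim: t j jn => [|t IH] j jn jt xy.
  have jE : j = n by lia.
  by move: xy; rewrite jE => /homologous_atn.
by apply: (IH j.+1); [lia | lia | apply: homologous_at_shift => //; lia].
Qed.

(** ** Fibrations *)

Definition normal_surjective A B (f : hom A B) : Prop :=
  forall P n (b : hom P (sob B n.+1)), projective P -> normal b ->
    exists a : hom P (sob A n.+1), normal a /\ smap f n.+1 ∘ a = b.

(** Descending induction on [k]. In a simplicial group, [b - s_k (d_k b)] has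
    null [k]-th face, so that it can be lifted by the case of [k.+1]. The cycle
    [d_k b] comes back, up to sign, as the face [k.+1] of this difference, hence
    it can be lifted as well, and so can [b], up to a correction of the face
    [k.+1] by a degenerate element of the kernel of [f]. *)
Lemma normal_surjective_at A B (f : hom A B) n k P (b : hom P (sob B n.+1)) :
  normal_surjective f -> projective P -> k <= n.+1 ->
  (forall i, i <= n.+1 -> i != k -> dface B n i ∘ b = null) ->
  exists a, (forall i, i <= n.+1 -> i != k -> dface A n i ∘ a = null) /\
    smap f n.+1 ∘ a = b.
Proof.
move=> fs pP kn; move: {2}(n.+1 - k) (erefl (n.+1 - k)) => t.
elim: t P k b pP kn => [|t IH] P k b pP kn kt b0.
  have kE : k = n.+1 by lia.
  have [|a [a0 fa]] := fs P n b pP; first by move=> i ni; apply: b0; lia.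
  by exists a; split=> // i ni ik; apply: a0; lia.
have [S _] := subtraction_exists hC hP pP; have pQ := @sub_proj _ _ _ S.
have IHQ (c : hom (sub_dom S) (sob B n.+1)) := IH _ k.+1 c pQ.
pose y := dface B n k ∘ b.
have yc : cycle y.
  rewrite /y; clear -b0 kt; case: n b b0 kt => // n b b0 kt i ni /=.
  case: (ltnP i k) => ik.
    by rewrite dface_dface_elt // b0 ?comp_zero //; lia.
  have := @dface_dface_elt B n k i.+1 _ b; rewrite ltnS ik /= => <- //.
  by rewrite b0 ?comp_zero //; lia.
have kn' : k <= n by lia.
have dy i : i <= n.+1 -> i != k.+1 ->
    dface B n i ∘ b = dface B n i ∘ (degen B n k ∘ y).
  move=> ni ik; case: (i =P k) => [->|/eqP ik'].
    by rewrite dface_degen_id_elt ?eqxx.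
  by rewrite b0 // dface_degen_cycle.
have [|||c [c0 fc]] := IHQ (sub_op S (degen B n k ∘ y) b); [lia | lia | |].
  by move=> i ni ik; rewrite sub_opN dy // sub_self.
have [|||c' [c'0 fc']] := IHQ (sub_op S b (degen B n k ∘ y)); [lia | lia | |].
  by move=> i ni ik; rewrite sub_opN dy // sub_self.
(* [c] lifts [s_k y - b], the face [k.+1] of which is [y - 0]; adding back 0
   gives a lifting of [y]. *)
pose h := sub_add (dface A n k.+1 ∘ c) (zero hC P _).
have fh : smap f n ∘ h = y.
  rewrite sub_addN comp_zero -dface_smap_elt fc sub_opN b0; [|lia..].
  by rewrite dface_degen_id_elt ?eqxx ?orbT // sub_addK.
have hc : cycle h.
  rewrite /h; clear -c0 kn'; case: n c c0 kn' => // n c c0 kn i ni /=.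
  rewrite sub_addN comp_zero; suff -> : dface A n i ∘ (dface A n.+1 k.+1 ∘ c) = null.
    by rewrite sub_add0.
  case: (ltnP i k.+1) => ik.
    by rewrite dface_dface_elt // c0 ?comp_zero //; lia.
  have := @dface_dface_elt A n k.+1 i.+1 _ c; rewrite ltnS ik /= => <- //.
  by rewrite c0 ?comp_zero //; lia.
pose e := sub_add c' (degen A n k ∘ h).
have fe : smap f n.+1 ∘ e = b.
  by rewrite /e sub_addN fc' compmA degen_smap -compmA fh sub_addK.
have e0 i : i <= n.+1 -> i != k -> i != k.+1 -> dface A n i ∘ e = null.
  by move=> ni ik ik'; rewrite sub_addN c'0 // dface_degen_cycle // sub_add0.
have ek : cycle (dface A n k ∘ e).
  by rewrite sub_addN c'0 ?dface_degen_id_elt ?eqxx ?sub_add0 //; lia.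
clearbody e.
have ec : cycle (dface A n k.+1 ∘ e).
  clear -e0 ek kn'; case: n e e0 ek kn' => // n e e0 ek kn i ni /=.
  case: (ltngtP i k) => ik.
  - by rewrite dface_dface_elt ?e0 ?comp_zero //; lia.
  - have := @dface_dface_elt A n k.+1 i.+1 _ e; rewrite ltnS ik /= => <- //.
    by rewrite e0 ?comp_zero //; lia.
  - by rewrite dface_dface_elt ik //=; exact: (ek k).
have fec : smap f n ∘ (dface A n k.+1 ∘ e) = null.
  by rewrite -dface_smap_elt fe b0 //; lia.
exists (maltsev S e (degen A n k ∘ (dface A n k.+1 ∘ e)) null); split.
  move=> i ni ik; rewrite maltsevN comp_zero; case: (i =P k.+1) => [->|/eqP ik'].
    by rewrite dface_degen_id_elt ?eqxx ?orbT // maltsev_left.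
  by rewrite e0 // dface_degen_cycle // maltsev_left.
rewrite maltsevN fe compmA degen_smap -compmA fec !comp_zero.
by rewrite maltsev_right.
Qed.

End Cycles.

Section KanFibrations.
Variables (C : category) (hC : semi_abelian C) (hP : enough_projectives C).
Implicit Types A B : simplicial C.
Local Notation null := (zero hC _ _).

(** As all horns in [A] can be filled, it is enough to fill horns of zeros
    compatibly with [f]: the filler is then corrected by its difference with the
    given simplex of [B]. *)
Lemma kan_fibrationE A B (f : hom A B) :
  kan_fibration f <-> normal_surjective hC f.
Proof.
split=> [fK P n b pP b0|fs n k X x b xh bx].
  have [||Y [p [a [pe fa a0]]]] := fK n ord_max P (fun _ _ => null) b.
  - by case: n {b b0} => //= n i j _ _ _; rewrite !comp_zero.
  - move=> i ik; rewrite faceE comp_zero; apply: b0.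
    by move: (ltn_ord i) ik; rewrite -val_eqE /=; lia.
  have [s ps] := pP _ _ p pe (idm P); exists (a ∘ s); split; last first.
    by rewrite compmA fa -compmA ps compm1.
  move=> i ni /=; have ik : inord i != ord_max :> 'I_n.+2.
    by rewrite -val_eqE /= inordK; lia.
  by have := a0 _ ik; rewrite dface_inord 1?ltnW // compmA => ->; rewrite !zero_comp.
have [P [p [pP pe]]] := hP X; have [S _] := subtraction_exists hC hP pP.
pose x' i := if @idP (inord i != k) is ReflectT ik then x _ ik ∘ p else null.
have x'E (i : 'I_n.+2) ik : x' i = x i ik ∘ p.
  rewrite /x'; case: {-}_ / idP => [ik'|]; last by rewrite inord_val.
  by move: ik'; rewrite inord_val => ik'; rewrite (bool_irrelevance ik' ik).
have [||y yx] := @horn_filler C hC hP A n k P x' pP; first by rewrite -ltnS.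
  case: n k x b xh bx x' x'E => // n k x b xh bx x' x'E i j ij jn ik jk.
  have jn' : j < n.+3 by [].
  have in' : i < n.+3 by exact: ltn_trans ij jn'.
  rewrite (x'E (Ordinal jn') jk) (x'E (Ordinal in') ik) !compmA.
  have := xh (Ordinal in') (Ordinal jn') ik jk ij.
  by rewrite /= !dface_inord ?[LHS]/=; [move=> -> | lia | lia].
have [|i ni ik|c [c0 fc]] := @normal_surjective_at C hC hP A B f n k _
    (sub_op S (b ∘ p) (smap f n.+1 ∘ y)) fs (@sub_proj _ _ _ S).
- by rewrite -ltnS.
- have ni' : i < n.+2 by [].
  have ik' : Ordinal ni' != k by [].
  rewrite sub_opN dface_smap_elt yx // (x'E _ ik') !compmA.
  by rewrite -(faceE B (Ordinal ni')) bx sub_self.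
exists P, p, (sub_add c y); split=> //.
  by rewrite sub_addN fc sub_addK.
move=> i ik; rewrite faceE sub_addN c0 ?sub_add0 ?yx -?x'E //; exact: (ltn_ord i).
Qed.

(** ** Trivial fibrations *)

(** The right lifting property with respect to the inclusions of spheres into
    disks; in dimension 0 this is the inclusion of 0 into a constant object. These
    turn out to be the trivial fibrations. *)
Definition disk_lifting A B (f : hom A B) : Prop :=
  (forall P (b : hom P (sob B 0)), projective P -> exists a, smap f 0 ∘ a = b) /\
  forall P n (x : hom P (sob A n)) (b : hom P (sob B n.+1)), projective P ->
    cycle hC x -> normal hC b -> dface B n n.+1 ∘ b = smap f n ∘ x ->
    exists a : hom P (sob A n.+1),
      [/\ normal hC a, dface A n n.+1 ∘ a = x & smap f n.+1 ∘ a = b].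

(** Homology isomorphisms on elements, see [homology_isoE]: the elements of the
    homology objects are the homology classes of cycles. *)
Definition homology_bijective A B (f : hom A B) : Prop :=
  forall P n, projective P ->
  (forall x x' : hom P (sob A n), cycle hC x -> cycle hC x' ->
     homologous hC (smap f n ∘ x) (smap f n ∘ x') -> homologous hC x x') /\
  (forall y : hom P (sob B n), cycle hC y ->
     exists x, cycle hC x /\ homologous hC y (smap f n ∘ x)).

Lemma disk_lifting_cycle A B (f : hom A B) P n (y : hom P (sob B n)) :
  disk_lifting f -> projective P -> cycle hC y ->
  exists x, cycle hC x /\ smap f n ∘ x = y.
Proof.
move=> [f0 fS] pP; case: n y => [|n] y yc.
  by have [x fx] := f0 P y pP; exists x.
have [|||x [x0 dx fx]] := fS P n null y pP.
- exact: cycle_null.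
- exact: cycle_normal.
- by rewrite comp_zero; exact: (yc n.+1).
exists x; split=> // i; rewrite leq_eqVlt => /orP[/eqP->|]; [exact: dx | exact: x0].
Qed.

Lemma disk_lifting_normal_surjective A B (f : hom A B) :
  disk_lifting f -> normal_surjective hC f.
Proof.
move=> fd P n b pP b0.
have [x [xc fx]] := disk_lifting_cycle fd pP (normal_boundary_cycle b0).
have [a [a0 _ fa]] := fd.2 P n x b pP xc b0 (esym fx).
by exists a.
Qed.

(** For injectivity, the simplex by which [f] identifies two classes is made
    normal by subtracting a degenerate simplex, is then lifted, and the
    subtraction is undone upstairs. *)
Lemma disk_lifting_homology A B (f : hom A B) :
  disk_lifting f -> homology_bijective f.
Proof.
move=> fd P n pP; split=> [x x' xc xc' [w [w0 wx wx']]|y yc]; last first.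
  have [x [xc fx]] := disk_lifting_cycle fd pP yc; exists x; split=> //.
  by rewrite fx; exact: homologous_refl.
have [S _] := subtraction_exists hC hP pP; have pQ := @sub_proj _ _ _ S.
pose v := sub_op S w (degen B n n ∘ (smap f n ∘ x)).
have v0 : normal hC v.
  move=> i; rewrite /= ltnS leq_eqVlt sub_opN => /orP[/eqP->|ni].
    by rewrite wx dface_degen_id_elt ?eqxx // sub_self.
  rewrite w0 // dface_degen_cycle ?sub_self //; try lia.
  exact: cycle_smap.
have [||a [a0 ax _]] := fd.2 _ n (sub_op S x' x) v pQ _ v0.
- case: n x x' xc xc' {w w0 wx wx' v v0} => // n x x' xc xc' i ni /=.
  by rewrite sub_opN (xc i) // (xc' i) // sub_self.
- by rewrite /v !sub_opN wx' dface_degen_id_elt ?eqxx ?orbT.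
exists (sub_add a (degen A n n ∘ x)); split=> [i ni||]; rewrite sub_addN.
- by rewrite (a0 i) ?sub_add0 ?dface_degen_cycle //; lia.
- by rewrite (a0 n) // sub_add0 dface_degen_id_elt ?eqxx.
- by rewrite ax dface_degen_id_elt ?eqxx ?orbT // sub_addK.
Qed.

(** Lift the boundary condition by injectivity on homology; the error is a cycle,
    homologous by surjectivity to one coming from [A], and hence by the
    fibration property itself the image of a cycle. *)
Lemma fibration_disk_lifting A B (f : hom A B) :
  normal_surjective hC f -> homology_bijective f -> disk_lifting f.
Proof.
move=> fs fh.
have cyc P n (y : hom P (sob B n)) : projective P -> cycle hC y ->
    exists x, cycle hC x /\ smap f n ∘ x = y.
  move=> pP yc; have [z [zc yz]] := (fh P n pP).2 y yc.
  have [w [w0 wz wy]] : homologous hC (smap f n ∘ z) y.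
    by apply: homologous_sym => //; exact: cycle_smap.
  have /kan_fibrationE fK := fs.
  pose x (i : 'I_n.+2) (_ : i != ord_max) := if i == n :> nat then z else null.
  have [||Y [p [a [pe fa ax]]]] := fK n ord_max P x w.
  - rewrite /x; case: n z zc {y yc yz w w0 wz wy x} => //= n z zc i j ik jk ij.
    move: ij (ltn_ord i) (ltn_ord j) ik jk; rewrite -!val_eqE /= => ij i3 j3 ik jk.
    rewrite !dface_inord ?comp_zero //; [|lia..].
    have -> : (i == n.+1 :> nat) = false by lia.
    by case: ifP => _; rewrite !comp_zero //; apply: (zc i); lia.
  - move=> i ik; rewrite faceE /x; case: eqP => [->|ni]; first exact: wz.
    rewrite comp_zero w0 //; move: (ltn_ord i) ik ni; rewrite -val_eqE /=; lia.
  have [s ps] := pP _ _ p pe (idm P).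
  have fas : smap f n.+1 ∘ (a ∘ s) = w by rewrite compmA fa -compmA ps compm1.
  exists (dface A n n.+1 ∘ (a ∘ s)); split; last first.
    by rewrite -dface_smap_elt fas.
  have as0 i : i <= n -> dface A n i ∘ (a ∘ s) = if i == n then z else null.
    move=> ni; have ik : inord i != ord_max :> 'I_n.+2.
      by rewrite -val_eqE /= inordK; lia.
    have ni1 : i <= n.+1 by exact: leqW.
    have iK : (inord i : 'I_n.+2) = i :> nat by rewrite inordK.
    have := ax _ ik; rewrite dface_inord // /x iK compmA => ->.
    by rewrite -compmA ps compm1.
  apply: cycle_last_face => [i ni|]; last by rewrite as0 // eqxx.
  by rewrite as0 1?ltnW // ltn_eqF.
split=> [P b pP|P n x b pP xc b0 bx].
  by have [|x [_ fx]] := cyc P 0 b pP; last by exists x.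
have [|w [w0 wn wx]] := (fh P n pP).1 null x (@cycle_null _ hC A n P) xc.
  exists b; split=> [i ni|//|//]; first by apply: b0; exact: ltnW.
  by rewrite comp_zero; exact: b0.
have w0' : normal hC w.
  by move=> i; rewrite ltnS leq_eqVlt => /orP[/eqP->|]; [exact: wn|exact: w0].
have [S _] := subtraction_exists hC hP pP; have pQ := @sub_proj _ _ _ S.
have [|c [cc fc]] := cyc _ n.+1 (sub_op S b (smap f n.+1 ∘ w)) pQ.
  move=> i; rewrite /= leq_eqVlt sub_opN => /orP[/eqP->|ni].
    by rewrite bx dface_smap_elt wx sub_self.
  by rewrite dface_smap_elt (w0' i) // (b0 i) // comp_zero sub_self.
exists (sub_add c w); split.
- by move=> i ni /=; rewrite sub_addN (cc i) ?(w0' i) ?sub_add0 // ltnW.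
- by rewrite sub_addN (cc n.+1) // sub_add0.
- by rewrite sub_addN fc sub_addK.
Qed.

End KanFibrations.

(** * Homology in terms of elements *)

Section Homology.
Variables (C : category) (hC : semi_abelian C) (hP : enough_projectives C).
Implicit Types A B : simplicial C.
Local Notation null := (zero hC _ _).
Let limC : has_finite_limits C :=
  regular_limits (exact_regular (semi_abelian_exact hC)).

Lemma joint_kernel_exists (X : C) (Y : nat -> C) (f : forall i, hom X (Y i)) n :
  exists (K : C) (k : hom K X), [/\ mono k, forall i, i < n -> f i ∘ k = null &
    forall T (a : hom T X), (forall i, i < n -> f i ∘ a = null) ->
      exists h, k ∘ h = a].
Proof.
elim: n => [|n [K [k [km k0 ku]]]].
  exists X, (idm X); split=> // [T a b|T a _]; first by rewrite !comp1m.
  by exists a; rewrite comp1m.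
have [L [l /(is_kernelE hC) [lm l0 lu]]] := kernel_exists hC (f n ∘ k).
exists L, (k ∘ l); split=> [T a b|i|T a a0].
- by rewrite -!compmA => /km/lm.
- rewrite ltnS leq_eqVlt => /orP[/eqP->|ni]; first by rewrite compmA.
  by rewrite compmA k0 // zero_comp.
- have [|h kh] := ku T a; first by move=> i ni; apply: a0; exact: ltnW.
  have [|h' lh] := lu T h; first by rewrite -compmA kh a0.
  by exists h'; rewrite -compmA lh.
Qed.

Section MooreComplex.
Variables (A : simplicial C) (N : moore_complex A).

Lemma moore_incl_normal n : normal hC (moore_incl N n).
Proof.
case: n => // n i ni /=; have [K [k [kk [kf _]]]] := moore_inclS N n.
have [h kh] := kf (Ordinal ni).
have /(is_kernelE hC) [_ k0 _] := kk (Ordinal ni).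
by rewrite faceE in k0; rewrite -kh compmA k0 zero_comp.
Qed.

Lemma moore_incl_mono n : mono (moore_incl N n).
Proof.
case: n => [|n]; first exact: is_iso_mono (moore_incl0 N).
have [K [k [_ [kf ku]]]] := moore_inclS N n.
move=> T a b ab; have [i|h [_ hu]] := ku T (moore_incl N n.+1 ∘ a).
  by have [h <-] := kf i; exists (h ∘ a); rewrite compmA.
by rewrite -(hu a) // -(hu b).
Qed.

Lemma moore_lift n T (g : hom T (sob A n)) :
  normal hC g -> exists h, moore_incl N n ∘ h = g.
Proof.
case: n g => [|n] g g0.
  by have [l [_ ll]] := moore_incl0 N; exists (l ∘ g); rewrite compmA ll comp1m.
have [K [k [kk [_ ku]]]] := moore_inclS N n.
have [i|h [hg _]] := ku T g; last by exists h.
have /(is_kernelE hC) [_ _ kku] := kk i; apply: kku.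
by rewrite faceE; apply: g0; exact: (ltn_ord i).
Qed.

Variables (n : nat) (Z : C) (z : hom Z (N n)).
Hypothesis zP : is_cycles z.
Let c := moore_incl N n ∘ z.

Lemma cycles_mono : mono c.
Proof.
move=> T a b; rewrite /c -!compmA => /moore_incl_mono.
case: n z zP => [|m] z' z'P; first exact: is_iso_mono.
by have /(is_kernelE hC) [km _ _] := z'P; exact: km.
Qed.

Lemma cycles_cycle : cycle hC c.
Proof.
rewrite /c; case: n z zP => [|m] z' z'P i; first by [].
rewrite leq_eqVlt => /orP[/eqP->|im]; last first.
  exact: face_null_comp (moore_incl_normal im).
have /(is_kernelE hC) [_ k0 _] := z'P.
have := moore_dE N m; rewrite faceE => dE.
by rewrite /= compmA -dE -compmA k0 comp_zero.
Qed.

Lemma cycles_lift T (g : hom T (sob A n)) :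
  cycle hC g -> exists h, c ∘ h = g.
Proof.
move=> gc; have [h hg] := moore_lift (cycle_normal gc).
suff [l lh] : exists l, z ∘ l = h by exists l; rewrite /c -compmA lh.
rewrite /c; case: n z zP g gc h hg => [|m] z' z'P g gc h hg.
  by case: z'P => y [_ yy]; exists (y ∘ h); rewrite compmA yy comp1m.
have /(is_kernelE hC) [_ _ ku] := z'P; apply: ku.
apply: (@moore_incl_mono m); have := moore_dE N m; rewrite faceE => dE.
by rewrite compmA dE -compmA hg comp_zero; exact: (gc m.+1).
Qed.

End MooreComplex.

Lemma moore_complex_exists A : exists _ : moore_complex A, True.
Proof.
pose Y n (i : nat) := sob A n.
have ex n := @joint_kernel_exists (sob A n.+1) (Y n) (dface A n) n.+1.
pose K n := projT1 (cid (ex n)).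
pose k n : hom (K n) (sob A n.+1) := projT1 (cid (projT2 (cid (ex n)))).
have kP n : [/\ mono (k n), forall i, i < n.+1 -> dface A n i ∘ k n = null &
    forall T (a : hom T (sob A n.+1)),
     (forall i, i < n.+1 -> dface A n i ∘ a = null) -> exists h, k n ∘ h = a].
  exact: (projT2 (cid (projT2 (cid (ex n))))).
clearbody k; clearbody K.
pose Nob n := if n is m.+1 then K m else sob A 0.
pose incl n : hom (Nob n) (sob A n) :=
  match n return hom (Nob n) (sob A n) with 0 => idm _ | m.+1 => k m end.
have incl_normal n : normal hC (incl n).
  by case: n => // n i ni; have [_ k0 _] := kP n; exact: k0.
have dex n : exists d : hom (Nob n.+1) (Nob n),
    incl n ∘ d = face A ord_max ∘ incl n.+1.
  case: n => [|n]; first by eexists; exact: comp1m.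
  have [_ _ ku] := kP n; apply: ku => i ni.
  have xc := normal_boundary_cycle (incl_normal n.+2).
  by rewrite faceE; apply: (xc i); exact: ltnW.
unshelve eexists (@MooreComplex C A Nob incl _ _ (fun n => projT1 (cid (dex n)))
  (fun n => projT2 (cid (dex n)))) => //; first exact: is_iso_idm.
move=> n; have [km k0 ku] := kP n.
pose kf (i : 'I_n.+1) := cid (kernel_exists hC (face A (widen_ord (leqnSn n.+1) i))).
exists (fun i => projT1 (kf i)), (fun i => projT1 (cid (projT2 (kf i)))).
have kfP (i : 'I_n.+1) : is_kernel (projT1 (cid (projT2 (kf i))))
    (face A (widen_ord (leqnSn n.+1) i)) by exact: (projT2 (cid (projT2 (kf i)))).
split=> //; split=> [i|T g gf].
  have /(is_kernelE hC) [_ _ kku] := kfP i; apply: kku.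
  by rewrite faceE; apply: k0; exact: (ltn_ord i).
have [|h hg] := ku T g.
  move=> i ni; have [h <-] := gf (Ordinal ni).
  have /(is_kernelE hC) [_ kk0 _] := kfP (Ordinal ni).
  by rewrite -(faceE A (widen_ord (leqnSn n.+1) (Ordinal ni))) compmA kk0 zero_comp.
by exists h; split=> // h' h'g; apply: km; rewrite hg.
Qed.

Lemma cycles_exists A (N : moore_complex A) n :
  exists (Z : C) (z : hom Z (N n)), is_cycles z.
Proof.
case: n => [|n]; last exact: kernel_exists.
by exists (N 0), (idm _); exact: is_iso_idm.
Qed.

Lemma boundary_exists A (N : moore_complex A) n (Z : C) (z : hom Z (N n)) :
  is_cycles z -> exists d, z ∘ d = moore_d N n.
Proof.
move=> zP; have [|d dE] := @cycles_lift A N n Z z zP _ (moore_incl N n ∘ moore_d N n).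
  rewrite moore_dE faceE; apply: normal_boundary_cycle; exact: moore_incl_normal.
by exists d; apply: (@moore_incl_mono A N n); rewrite compmA.
Qed.

(** Homologous cycles form a reflexive relation internal to [C]. By
    [reflexive_quotient] its coequalizer identifies only homologous elements, and
    this coequalizer is a cokernel of the differential since the difference of
    two homologous cycles is a boundary. *)
Lemma homology_projection A n (N : moore_complex A) (Z H : C) (z : hom Z (N n))
    (d : hom (N n.+1) Z) (q : hom Z H) :
  is_cycles z -> z ∘ d = moore_d N n -> is_cokernel q d ->
  forall P (x y : hom P Z), projective P -> (q ∘ x = q ∘ y <->
    homologous hC (moore_incl N n ∘ z ∘ x) (moore_incl N n ∘ z ∘ y)).
Proof.
move=> zP zd [/(is_zero_mapE hC) qd qu].
pose c := moore_incl N n ∘ z.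
have cm : mono c := cycles_mono zP.
have cc : cycle hC c := cycles_cycle zP.
have cl := cycles_lift zP; rewrite -/c in cl *.
pose t := moore_incl N n.+1.
have td : dface A n n.+1 ∘ t = c ∘ d.
  by rewrite /c -compmA zd moore_dE faceE.
have t0 : normal hC t := @moore_incl_normal A N n.+1.
have tl := @moore_lift A N n.+1; rewrite -/t in tl.
clearbody c t; clear z zP zd.
have [M [m [mm m0 ml]]] := @joint_kernel_exists _ _ (dface A n) n.
have [R [u [r [cu Rl]]]] := pullback limC c (dface A n n ∘ m).
have rmono T (a b : hom T R) : u ∘ a = u ∘ b -> m ∘ r ∘ a = m ∘ r ∘ b -> a = b.
  rewrite -!compmA => ua /mm ra.
  have [|h [_ hu]] := Rl T (u ∘ a) (r ∘ a); first by rewrite !compmA cu.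
  by rewrite -(hu a) // -(hu b).
have Rlift T (w : hom T (sob A n.+1)) (x : hom T Z) :
    (forall i, i < n -> dface A n i ∘ w = null) -> dface A n n ∘ w = c ∘ x ->
    exists s, u ∘ s = x /\ m ∘ r ∘ s = w.
  move=> w0 wx; have [l lw] := ml T w w0.
  have [|s [[us rs] _]] := Rl T x l; first by rewrite -wx -compmA lw.
  by exists s; rewrite -(compmA m) rs.
have r0 i : i < n -> dface A n i ∘ (m ∘ r) = null.
  by move=> ni; rewrite compmA m0 // zero_comp.
have ru : dface A n n ∘ (m ∘ r) = c ∘ u by rewrite compmA -cu.
have [v cv] : exists v, c ∘ v = dface A n n.+1 ∘ (m ∘ r).
  by apply: cl; apply: cycle_last_face => //; rewrite ru; exact: cycle_comp.
(* Reflexivity comes from the degenerate simplices. *)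
have [e [ue re]] : exists e, u ∘ e = idm Z /\ m ∘ r ∘ e = degen A n n ∘ c.
  apply: Rlift => [i ni|]; first by rewrite dface_degen_cycle //; lia.
  by rewrite dface_degen_id_elt ?eqxx // compm1.
have ve : v ∘ e = idm Z.
  apply: cm; rewrite compmA cv -compmA re dface_degen_id_elt ?eqxx ?orbT //.
  by rewrite compm1.
have [Q [q0 [[q0uv q0u] q0P]]] := reflexive_quotient hC hP ue ve.
have quv : q ∘ u = q ∘ v.
  apply: (element_ext hP) => P s pP.
  have [S _] := subtraction_exists hC hP pP.
  pose w := sub_op S (m ∘ r ∘ s) (degen A n n ∘ (c ∘ (u ∘ s))).
  have [|h th] := tl _ w.
    move=> i; rewrite /= ltnS leq_eqVlt sub_opN => /orP[/eqP->|ni].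
      by rewrite compmA ru dface_degen_id_elt ?eqxx // compmA sub_self.
    rewrite compmA r0 // zero_comp dface_degen_cycle ?sub_self //; try lia.
    exact: cycle_comp.
  have dh : d ∘ h = sub_op S (v ∘ s) (u ∘ s).
    apply: cm; rewrite compmA -td -compmA th /w !sub_opN (compmA _ (m ∘ r)) -cv.
    by rewrite dface_degen_id_elt ?eqxx ?orbT // (compmA c v).
  rewrite -!compmA -[RHS](sub_addK S _ (q ∘ (u ∘ s))) -sub_opN -dh (compmA q d) qd.
  by rewrite zero_comp sub_add0.
have q0d : q0 ∘ d = null.
  apply: (element_ext hP) => P h pP; rewrite zero_comp -compmA.
  have [||s [us rs]] := Rlift P (t ∘ h) null.
  - by move=> i ni; rewrite compmA (t0 i) ?zero_comp //; exact: ltnW.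
  - by rewrite compmA (t0 n) // comp_zero zero_comp.
  have <- : v ∘ s = d ∘ h.
    by apply: cm; rewrite compmA cv -(compmA (dface A n n.+1)) rs !compmA td.
  by rewrite compmA -q0uv -compmA us comp_zero.
have [k [kq _]] : exists! k, k ∘ q = q0 by apply: qu; exact/(is_zero_mapE hC).
move=> P x y pP; split=> [qxy|[w [w0 wx wy]]].
  have [|s [us vs]] := q0P P x y pP; first by rewrite -kq -!compmA qxy.
  exists (m ∘ r ∘ s); rewrite !(compmA _ (m ∘ r)) ru -cv -us -vs !compmA.
  by split=> // i ni; rewrite compmA r0 // zero_comp.
have [s [us rs]] := Rlift P w x w0 wx.
have vs : v ∘ s = y by apply: cm; rewrite compmA cv -(compmA (dface A n n.+1)) rs.
by rewrite -us -vs !compmA quv.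
Qed.

Lemma cokernel_regular_epi (X Y Q : C) (q : hom Y Q) (f : hom X Y) :
  is_cokernel q f -> regular_epi q.
Proof.
move=> [/(is_zero_mapE hC) qf qu]; exists X, f, null; split.
  by rewrite qf comp_zero.
move=> T a; rewrite comp_zero => af; apply: qu; exact/(is_zero_mapE hC).
Qed.

Lemma homology_exists A n : exists _ : homology A n, True.
Proof.
have [N _] := moore_complex_exists A; have [Z [z zP]] := cycles_exists N n.
have [d zd] := boundary_exists zP.
have [H [q [qd qu]]] := coequalizer_exists hC hP d null.
unshelve eexists (@Homology C A n N Z z zP d zd H q _) => //.
split; first by apply/(is_zero_mapE hC); rewrite qd comp_zero.
by move=> T a /(is_zero_mapE hC) ad; apply: qu; rewrite ad comp_zero.
Qed.

Lemma homology_map_exists A B (f : hom A B) n (HA : homology A n)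
    (HB : homology B n) : exists h : hom HA HB, is_homology_map f h.
Proof.
have [fN fNE] := moore_lift (hmoore HB)
  (normal_smap f (@moore_incl_normal A (hmoore HA) n)).
have fc : cycle hC (smap f n ∘ (moore_incl (hmoore HA) n ∘ hcycles_incl HA)).
  by apply: cycle_smap; apply: cycles_cycle; exact: hcyclesP.
have [fZ fZE] := cycles_lift (hcyclesP HB) fc.
have fNZ : hcycles_incl HB ∘ fZ = fN ∘ hcycles_incl HA.
  apply: (@moore_incl_mono B (hmoore HB) n).
  by rewrite !compmA fNE -!compmA -fZE compmA.
have [/(is_zero_mapE hC) qd qu] := hprojP HA.
have [|h [hq _]] := qu _ (hproj HB ∘ fZ); last first.
  by exists h, fN, fZ; rewrite hq.
apply/(is_zero_mapE hC); apply: (element_ext hP) => P s pP.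
rewrite zero_comp -!compmA -(comp_zero hC P (hproj HB)).
apply/(homology_projection (hcyclesP HB) (hboundP HB) (hprojP HB)) => //.
rewrite comp_zero (compmA _ fZ) fZE -!compmA (compmA (hcycles_incl HA)) hboundP.
rewrite (compmA (moore_incl _ n)) moore_dE faceE.
apply: homologous_sym => //; first exact: cycle_null.
  apply: cycle_smap; apply: cycle_comp.
  by apply: normal_boundary_cycle; exact: moore_incl_normal.
exists (smap f n.+1 ∘ (moore_incl (hmoore HA) n.+1 ∘ s)).
rewrite !dface_smap_elt; split=> [i ni||].
- by rewrite dface_smap_elt (compmA (dface A n i)) (@moore_incl_normal A (hmoore HA) n.+1 i)
    ?zero_comp ?comp_zero //; exact: ltnW.
- by rewrite (compmA (dface A n n)) (@moore_incl_normal A (hmoore HA) n.+1 n)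
    ?zero_comp ?comp_zero.
- by rewrite !compmA.
Qed.

Lemma homology_map_iso A B (f : hom A B) n (HA : homology A n)
    (HB : homology B n) (h : hom HA HB) : is_homology_map f h ->
  is_iso h <-> forall P, projective P ->
    (forall x x' : hom P (sob A n), cycle hC x -> cycle hC x' ->
     homologous hC (smap f n ∘ x) (smap f n ∘ x') -> homologous hC x x') /\
    (forall y : hom P (sob B n), cycle hC y ->
     exists x, cycle hC x /\ homologous hC y (smap f n ∘ x)).
Proof.
move=> [fN [fZ [fNE fZE hE]]].
have pA := homology_projection (hcyclesP HA) (hboundP HA) (hprojP HA).
have pB := homology_projection (hcyclesP HB) (hboundP HB) (hprojP HB).
have lA := cycles_lift (hcyclesP HA); have lB := cycles_lift (hcyclesP HB).
have cA := cycles_cycle (hcyclesP HA); have cB := cycles_cycle (hcyclesP HB).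
have eA := cokernel_regular_epi (hprojP HA).
have eB := cokernel_regular_epi (hprojP HB).
have ff : moore_incl (hmoore HB) n ∘ hcycles_incl HB ∘ fZ =
    smap f n ∘ (moore_incl (hmoore HA) n ∘ hcycles_incl HA).
  by rewrite -compmA fZE !compmA fNE.
have ffx T (x : hom T (hcycles HA)) :
    smap f n ∘ (moore_incl (hmoore HA) n ∘ hcycles_incl HA ∘ x) =
    moore_incl (hmoore HB) n ∘ hcycles_incl HB ∘ (fZ ∘ x).
  by rewrite (compmA _ fZ) ff -!compmA.
split=> [hi P pP|hb].
  split=> [x x' xc x'c|y yc].
    have [z <-] := lA _ _ xc; have [z' <-] := lA _ _ x'c.
    rewrite !ffx => /(pB _ _ _ pP) zz'; apply/(pA _ _ _ pP).
    by apply: (is_iso_mono hi); rewrite !compmA hE -!compmA.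
  have [w wy] := lB _ _ yc; have [g [_ hg]] := hi.
  have [z zE] := pP _ _ _ eA (g ∘ (hproj HB ∘ w)).
  exists (moore_incl (hmoore HA) n ∘ hcycles_incl HA ∘ z).
  split; first exact: cycle_comp.
  rewrite -wy ffx; apply/(pB _ _ _ pP).
  by rewrite compmA -hE -compmA zE compmA hg comp1m.
apply: (element_iso hC hP) => [|P pP y].
  apply: (element_mono hP) => P a b pP.
  have [x <-] := pP _ _ _ eA a; have [x' <-] := pP _ _ _ eA b.
  rewrite !compmA hE -!compmA => /(pB _ _ _ pP); rewrite -!ffx => hxx'.
  by apply/(pA _ _ _ pP); apply: (hb P pP).1 => //; exact: cycle_comp.
have [w <-] := pP _ _ _ eB y.
have [x [xc]] := (hb P pP).2 _ (cycle_comp w cB).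
have [z <-] := lA _ _ xc; rewrite ffx => /(pB _ _ _ pP) ->.
by exists (hproj HA ∘ z); rewrite !compmA hE.
Qed.

Lemma homology_isoE A B (f : hom A B) :
  homology_iso f <-> homology_bijective hC f.
Proof.
split=> [fH P n pP|fb n].
  by have [HA [HB [h [hf /(homology_map_iso hf) hb]]]] := fH n; exact: hb.
have [HA _] := homology_exists A n; have [HB _] := homology_exists B n.
have [h hf] := homology_map_exists f HA HB; exists HA, HB, h; split=> //.
by apply/(homology_map_iso hf) => P pP; exact: fb.
Qed.

(** ** Two out of three and retracts *)

Lemma homology_bijective_comp A B D (f : hom A B) (g : hom B D) :
  homology_bijective hC f -> homology_bijective hC g ->
  homology_bijective hC (g ∘ f).
Proof.
move=> fb gb P n pP; have [fi fs] := fb P n pP; have [gi gs] := gb P n pP.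
split=> [x x' xc xc'|y yc].
  by rewrite /smap /= -!compmA => /gi h; apply: fi => //; apply: h; exact: cycle_smap.
have [z [zc yz]] := gs y yc; have [x [xc zx]] := fs z zc.
exists x; split=> //; apply: (homologous_trans hP pP _ yz).
  exact: cycle_smap.
by rewrite /smap /= -compmA; exact: homologous_smap.
Qed.

Lemma homology_bijective_cancell A B D (f : hom A B) (g : hom B D) :
  homology_bijective hC g -> homology_bijective hC (g ∘ f) ->
  homology_bijective hC f.
Proof.
move=> gb fb P n pP; have [fi fs] := fb P n pP; have [gi gs] := gb P n pP.
split=> [x x' xc xc' /(homologous_smap g)|y yc].
  by rewrite !compmA; exact: fi.
have [x [xc yx]] := fs _ (cycle_smap g yc); exists x; split=> //.
apply: gi => //; first exact: cycle_smap.
by rewrite compmA.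
Qed.

Lemma homology_bijective_cancelr A B D (f : hom A B) (g : hom B D) :
  homology_bijective hC f -> homology_bijective hC (g ∘ f) ->
  homology_bijective hC g.
Proof.
move=> fb gb P n pP; have [fi fs] := fb P n pP; have [gi gs] := gb P n pP.
split=> [y y' yc yc' yy'|z zc]; last first.
  have [x [xc zx]] := gs z zc; exists (smap f n ∘ x).
  by split; [exact: cycle_smap | rewrite compmA].
have [x [xc yx]] := fs y yc; have [x' [xc' yx']] := fs y' yc'.
have fxc := cycle_smap f xc; have fxc' := cycle_smap f xc'.
apply: (homologous_trans hP pP fxc yx).
apply: (homologous_trans hP pP fxc'); last exact: homologous_sym.
apply: homologous_smap; apply: gi => //.
rewrite /smap /= -!compmA.
have gyc := cycle_smap g yc; have gyc' := cycle_smap g yc'.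
apply: (homologous_trans hP pP gyc).
  apply: homologous_sym => //; first exact: cycle_smap.
  exact: homologous_smap.
apply: (homologous_trans hP pP gyc' yy'); exact: homologous_smap.
Qed.

Lemma homology_bijective_retract : retract_closed (@homology_bijective C hC).
Proof.
move=> X Y X' Y' f g [s [r [s' [r' [rs rs' gs fr]]]]] gb P n pP.
have [gi gsu] := gb P n pP.
have rsx T (x : hom T (sob X n)) : smap r n ∘ (smap s n ∘ x) = x.
  by rewrite compmA -[_ ∘ smap s n]/(smap (r ∘ s) n) rs comp1m.
split=> [x x' xc xc' /(homologous_smap s')|y yc].
  rewrite !compmA -[smap s' n ∘ smap f n]/(smap (s' ∘ f) n) -gs /smap /= -!compmA.
  move=> /gi h; rewrite -(rsx _ x) -(rsx _ x'); apply: homologous_smap.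
  by apply: h; exact: cycle_smap.
have [x [xc yx]] := gsu _ (cycle_smap s' yc); exists (smap r n ∘ x).
split; first exact: cycle_smap.
have := homologous_smap r' yx.
rewrite !compmA -[smap r' n ∘ smap s' n]/(smap (r' ∘ s') n) rs' comp1m.
by rewrite -[smap r' n ∘ smap g n]/(smap (r' ∘ g) n) -fr.
Qed.

Lemma normal_surjective_retract : retract_closed (@normal_surjective C hC).
Proof.
move=> X Y X' Y' f g [s [r [s' [r' [rs rs' gs fr]]]]] gn P n b pP b0.
have [a [a0 ga]] := gn P n _ pP (normal_smap s' b0).
exists (smap r n.+1 ∘ a); split; first exact: normal_smap.
rewrite compmA -[smap f _ ∘ smap r _]/(smap (f ∘ r) n.+1) fr /smap /= -compmA.
rewrite -[X in _ ∘ X]/(smap g n.+1 ∘ a) ga compmA.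
by rewrite -[_ ∘ smap s' _]/(smap (r' ∘ s') n.+1) rs' comp1m.
Qed.

End Homology.

(** * Attaching cells *)

Local Notation simplex m n := (@hom simplex_category m n).

Section Pull.
Variable C : category.
Implicit Types A B : simplicial C.

Definition pull A m n (u : simplex m n) : hom (sob A n) (sob A m) :=
  @fmap _ _ A n m u.

Lemma pull_act A m n (u : simplex m n) : pull A u = act A m n (simplex_fun u).
Proof. exact: act_fmap. Qed.

Lemma pull_comp A m n p (v : simplex n p) (u : simplex m n) :
  pull A u ∘ pull A v = pull A (v ∘ u).
Proof. by rewrite /pull -fmapM. Qed.

Lemma pull_id A n : pull A (@idm simplex_category n) = idm _.
Proof. exact: (fmap1 A). Qed.

Lemma pull_smap A B (f : hom A B) m n (u : simplex m n) :
  smap f m ∘ pull A u = pull B u ∘ smap f n.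
Proof. exact: (ncompP f). Qed.

Lemma face_null_missing (hC : semi_abelian C) A n i T (x : hom T (sob A n)) m
    (u : simplex m n) : i <= n -> face_null hC i x ->
  (forall j, j <= m -> simplex_fun u j != i) -> pull A u ∘ x = zero hC _ _.
Proof.
have uP := simplex_fun_nondecreasing u.
rewrite pull_act; move: (simplex_fun u) uP => g gP.
case: n x u gP => [|n] x u gP ni x0 gi.
  by have := gi 0 isT; case: gP => /(_ 0 isT); lia.
have <- : act A m n (unbump i \o g) ∘ dface A n i = act A m n.+1 g.
  rewrite act_comp; last exact: nondecreasing_bump.
    by apply: eq_act => j jm; have := gi j jm; rewrite /= /bump /unbump; lia.
  case: gP => gn gm; split=> [j jm|j k jk km] /=.
    by have := gn j jm; have := gi j jm; rewrite /unbump; lia.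
  by have := gm j k jk km; rewrite /unbump; lia.
by rewrite -compmA x0 comp_zero.
Qed.

End Pull.

Section Cells.
Variables (C : category) (hC : semi_abelian C) (hP : enough_projectives C).
Local Notation null := (zero hC _ _).

Section Extension.
Variables (X : simplicial C) (P : nat -> C).
Variable free : forall n m, simplex m n -> bool.
Variable bd : forall n m, simplex m n -> hom (P n) (sob X m).

(** The extension of [X] by one cell of each dimension [n], with coefficients in
    [P n]. Its [m]-simplices consist of those of [X] and of one copy of [P n] for
    each free operator [u], from [m] to [n]; the other operators [u] take the cell
    to the simplex [bd u] of [X]. In this explicit form the extension is
    available without infinite coproducts, since there are only finitely many
    free operators in each degree [m]. *)
Record cell_extension := CellExtension {
  ext_ob :> simplicial C;
  ext_incl : hom X ext_ob;
  ext_cell : forall n m (u : simplex m n), hom (P n) (sob ext_ob m);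
  ext_cell_pull : forall n m k (u : simplex m n) (v : simplex k m),
    pull ext_ob v ∘ ext_cell u = ext_cell (u ∘ v);
  ext_cell_bd : forall n m (u : simplex m n), ~~ free u ->
    ext_cell u = smap ext_incl m ∘ bd u;
  ext_map : forall m T (a : hom (sob X m) T)
    (b : forall n (u : simplex m n), hom (P n) T),
    exists h, h ∘ smap ext_incl m = a /\
      forall n (u : simplex m n), free u -> h ∘ ext_cell u = b n u;
  ext_map_ext : forall m T (h h' : hom (sob ext_ob m) T),
    h ∘ smap ext_incl m = h' ∘ smap ext_incl m ->
    (forall n (u : simplex m n), free u -> h ∘ ext_cell u = h' ∘ ext_cell u) ->
    h = h' }.

Hypothesis free_comp : forall n m k (u : simplex m n) (v : simplex k m),
  free (u ∘ v) -> free u.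
Hypothesis free_dim : forall n m (u : simplex m n), free u -> n <= m.+1.
Hypothesis bd_pull : forall n m k (u : simplex m n) (v : simplex k m),
  ~~ free u -> bd (u ∘ v) = pull X v ∘ bd u.

Lemma cell_extension_exists : exists _ : cell_extension, True.
Proof.
pose I m := {classic option {n : nat & simplex m n}}.
pose F m (i : I m) := if i is Some c then P (projT1 c) else sob X m.
pose cell m n (u : simplex m n) : I m := Some (existT _ n u).
have ls m : exists s : seq (I m), (None : I m) \in s /\
    forall n (u : simplex m n), ((cell m n u : I m) \in s) = free u.
  pose L n : seq (simplex m n) :=
    enum [pred u : {f : {ffun 'I_m.+1 -> 'I_n.+1} | monotone f} | free (u : simplex m n)].
  exists ((None : I m) :: flatten [seq [seq cell m n u | u <- L n] | n <- iota 0 m.+2]).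
  rewrite inE eqxx; split=> // n u; rewrite inE; apply/idP/idP => [|uf].
    case/orP => [/eqP //|].
    case/flattenP => s /(@mapP nat (seq (I m)))[n' _ ->] /mapP[u' u's] e.
    have : free u' by move: u's; rewrite mem_enum inE.
    move: e => /(congr1 (fun i : option {n : nat & simplex m n} =>
      if i is Some c then free (projT2 c) else true)) /= -> //.
  apply/orP; right; apply/flattenP; exists [seq cell m n u | u <- L n].
    apply/(@mapP nat (seq (I m))); exists n => //.
    by rewrite mem_iota /= add0n ltnS (free_dim uf).
  by apply/mapP; exists u; rewrite // mem_enum inE.
pose s m := projT1 (cid (ls m)).
have sN m : (None : I m) \in s m by exact: (projT2 (cid (ls m))).1.
have sS m n (u : simplex m n) : ((cell m n u : I m) \in s m) = free u.
  exact: (projT2 (cid (ls m))).2.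
clearbody s.
have ex m := list_coproduct_exists hC (@F m) (s m).
pose Z m := projT1 (cid (ex m)).
pose c m : forall i, hom (F m i) (Z m) := projT1 (cid (projT2 (cid (ex m)))).
have cP m : list_coproduct (s m) (c m).
  exact: (projT2 (cid (projT2 (cid (ex m))))).
clearbody c; clearbody Z.
pose inc m : hom (sob X m) (Z m) := c m None.
pose cel n m (u : simplex m n) : hom (P n) (Z m) :=
  if free u then c m (cell m n u) else inc m ∘ bd u.
have celbd n m (u : simplex m n) : ~~ free u -> cel n m u = inc m ∘ bd u.
  by rewrite /cel => /negbTE ->.
have mapex m T (a : hom (sob X m) T) (b : forall n (u : simplex m n), hom (P n) T) :
    exists h : hom (Z m) T, h ∘ inc m = a /\
      forall n (u : simplex m n), free u -> h ∘ cel n m u = b n u.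
  have [h hE] := (cP m).1 T (fun i => match i return hom (F m i) T with
    | None => a | Some v => b (projT1 v) (projT2 v) end).
  exists h; split; first exact: (hE None (sN m)).
  by move=> n u uf; rewrite /cel uf (hE (cell m n u)) // sS.
have mapu m T (h h' : hom (Z m) T) : h ∘ inc m = h' ∘ inc m ->
    (forall n (u : simplex m n), free u -> h ∘ cel n m u = h' ∘ cel n m u) -> h = h'.
  move=> hi hc; apply: (cP m).2 => -[[n u]|] //.
  rewrite -[Some _]/(cell m n u) sS => uf.
  by have := hc n u uf; rewrite /cel uf.
clearbody cel inc.
have Zex m k (v : @hom (op simplex_category) m k) : exists h : hom (Z m) (Z k),
    h ∘ inc m = inc k ∘ fmap X v /\
    forall n (u : simplex m n), h ∘ cel n m u = cel n k (u ∘ (v : simplex k m)).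
  have [h [hi hc]] := mapex m _ (inc k ∘ fmap X v)
    (fun n u => cel n k (u ∘ (v : simplex k m))).
  exists h; split=> // n u; case: (boolP (free u)) => [|uf]; first exact: hc.
  have uvf : ~~ free (u ∘ (v : simplex k m)) by apply: contra uf; exact: free_comp.
  by rewrite !celbd // compmA hi -compmA bd_pull.
pose Zmap m k v := projT1 (cid (Zex m k v)).
have ZmapI m k v : Zmap m k v ∘ inc m = inc k ∘ fmap X v.
  exact: (projT2 (cid (Zex m k v))).1.
have ZmapC m k (v : simplex k m) n u : Zmap m k v ∘ cel n m u = cel n k (u ∘ v).
  exact: (projT2 (cid (Zex m k v))).2.
clearbody Zmap.
have Zmap1 m : Zmap m m (idm _) = idm _.
  apply: mapu => [|n u _]; first by rewrite ZmapI fmap1 comp1m compm1.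
  by rewrite ZmapC comp1m compm1.
have ZmapM m k l (v : @hom (op simplex_category) k l) (w : @hom (op simplex_category) m k) :
    Zmap m l (v ∘ w) = Zmap k l v ∘ Zmap m k w.
  apply: mapu => [|n u _].
    by rewrite -(compmA (Zmap k l v)) !ZmapI (compmA (Zmap k l v)) ZmapI fmapM compmA.
  by rewrite -compmA !ZmapC -compmA.
pose ZF : simplicial C := @Functor (op simplex_category) C Z Zmap Zmap1 ZmapM.
pose incn : @hom (simplicial C) X ZF :=
  @NatTrans _ _ X ZF (fun m => inc m) (fun m k v => esym (ZmapI m k v)).
unshelve eexists (@CellExtension ZF incn cel _ _ _ _) => //.
by move=> n m k u v; exact: ZmapC.
Qed.

End Extension.

Section ExtensionTheory.
Variables (X : simplicial C) (P : nat -> C).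
Variable free : forall n m, simplex m n -> bool.
Variable bd : forall n m, simplex m n -> hom (P n) (sob X m).
Variable Z : cell_extension free bd.

Definition ext_gen n : hom (P n) (sob Z n) := ext_cell Z (@idm simplex_category n).

Lemma ext_genE n m (u : simplex m n) : ext_cell Z u = pull Z u ∘ ext_gen n.
Proof. by rewrite ext_cell_pull comp1m. Qed.

Lemma ext_incl_iso m :
  (forall n (u : simplex m n), ~~ free u) -> is_iso (smap (ext_incl Z) m).
Proof.
move=> nf; have [r [ri _]] := ext_map Z (idm (sob X m))
  (fun n (u : simplex m n) => zero hC (P n) (sob X m)).
exists r; split=> //; apply: (ext_map_ext (c := Z)) => [|n u uf].
  by rewrite -compmA ri compm1 comp1m.
by have := nf n u; rewrite uf.
Qed.

Lemma ext_hom (W : simplicial C) (g : hom X W) (w : forall n, hom (P n) (sob W n)) :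
  (forall n m (u : simplex m n), ~~ free u -> pull W u ∘ w n = smap g m ∘ bd u) ->
  exists h : hom (Z : simplicial C) W, h ∘ ext_incl Z = g /\
    forall n m (u : simplex m n), smap h m ∘ ext_cell Z u = pull W u ∘ w n.
Proof.
move=> wb.
have hex m : exists h : hom (sob Z m) (sob W m), h ∘ smap (ext_incl Z) m = smap g m /\
    forall n (u : simplex m n), h ∘ ext_cell Z u = pull W u ∘ w n.
  have [h [hi hc]] := ext_map Z (smap g m) (fun n (u : simplex m n) => pull W u ∘ w n).
  exists h; split=> // n u; case: (boolP (free u)) => [|uf]; first exact: hc.
  by rewrite ext_cell_bd // compmA hi wb.
pose h m := projT1 (cid (hex m)).
have hi m : h m ∘ smap (ext_incl Z) m = smap g m by exact: (projT2 (cid (hex m))).1.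
have hc m n (u : simplex m n) : h m ∘ ext_cell Z u = pull W u ∘ w n.
  exact: (projT2 (cid (hex m))).2.
clearbody h.
have hn m k (v : @hom (op simplex_category) m k) :
    h k ∘ fmap (ext_ob Z) v = fmap W v ∘ h m.
  rewrite -[fmap (ext_ob Z) v]/(pull Z (v : simplex k m)) -[fmap W v]/(pull W (v : simplex k m)).
  apply: (ext_map_ext (c := Z)) => [|n u _].
    by rewrite -!compmA -pull_smap hi compmA hi pull_smap.
  by rewrite -!compmA ext_cell_pull !hc compmA pull_comp.
exists (@NatTrans _ _ (ext_ob Z) W h hn); split.
  by apply: nattransP => m; exact: hi.
by move=> n m u; exact: hc.
Qed.

Lemma ext_hom_ext (W : simplicial C) (h h' : hom (Z : simplicial C) W) :
  h ∘ ext_incl Z = h' ∘ ext_incl Z ->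
  (forall n m (u : simplex m n), free u ->
     smap h n ∘ ext_gen n = smap h' n ∘ ext_gen n) -> h = h'.
Proof.
move=> hi hg; apply: nattransP => m.
apply: (ext_map_ext (c := Z)) => [|n u uf].
  by have := congr1 (fun t => smap t m) hi.
rewrite -[h m]/(smap h m) -[h' m]/(smap h' m).
by rewrite ext_genE !compmA !pull_smap -!compmA (hg _ _ _ uf).
Qed.

Lemma ext_lift (E B : simplicial C) (q : hom E B) (a : hom X E)
    (b : hom (Z : simplicial C) B) :
  q ∘ a = b ∘ ext_incl Z ->
  (forall n, exists w : hom (P n) (sob E n),
    (forall m (u : simplex m n), ~~ free u -> pull E u ∘ w = smap a m ∘ bd u) /\
    forall m (u : simplex m n), free u -> smap q n ∘ w = smap b n ∘ ext_gen n) ->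
  exists h : hom (Z : simplicial C) E, h ∘ ext_incl Z = a /\ q ∘ h = b.
Proof.
move=> qa wex; pose w n := projT1 (cid (wex n)).
have wb n m (u : simplex m n) : ~~ free u -> pull E u ∘ w n = smap a m ∘ bd u.
  exact: (projT2 (cid (wex n))).1.
have [h [hi hc]] := ext_hom wb; exists h; split=> //.
apply: ext_hom_ext => [|n m u uf]; first by rewrite -compmA hi.
rewrite /smap /= -compmA hc pull_id comp1m.
exact: (projT2 (cid (wex n))).2 uf.
Qed.

End ExtensionTheory.

End Cells.

(** * Factorizations *)

Section Factorizations.
Variables (C : category) (hC : semi_abelian C) (hP : enough_projectives C).
Implicit Types A B X Y : simplicial C.
Local Notation null := (zero hC _ _).

(** ** Homotopies *)

(** A homotopy is given as a family [H m phi] indexed by the [m]-simplices [phi]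
    of the interval. The simplices [H m.+1 phi] of degenerate cycles connect the
    values of [H m] at the successive steps from the constant 1 to the
    constant 0. *)
Lemma homotopy_homologous A B
    (H : forall m, (nat -> nat) -> hom (sob A m) (sob B m)) :
  (forall m phi psi, (forall i, i <= m -> phi i = psi i) -> H m phi = H m psi) ->
  (forall m k g phi, nondecreasing k m g -> nondecreasing m 1 phi ->
     act B k m g ∘ H m phi = H k (phi \o g) ∘ act A k m g) ->
  forall n P (x : hom P (sob A n)), projective P -> cycle hC x ->
  homologous hC (H n (fun _ => 1) ∘ x) (H n (fun _ => 0) ∘ x).
Proof.
move=> Hext Hnat n P x pP xc.
pose step j := fun i : nat => nat_of_bool (j <= i).
have stepP m j : nondecreasing m 1 (step j).
  by split=> [i _|i i' ii _]; rewrite /step; lia.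
pose c j := H n (step j) ∘ x.
have cc j : cycle hC (c j).
  rewrite /c; case: n x xc {c} => [//|n] x xc i ni /=.
  rewrite compmA Hnat; [|exact: nondecreasing_bump|exact: stepP].
  by rewrite -compmA -/(dface A n i) (xc i ni) comp_zero.
have cS j : j <= n -> homologous hC (c j) (c j.+1).
  move=> jn; apply: (homologous_at_homologous hP pP (cc j) (cc j.+1) jn).
  exists (H n.+1 (step j.+1) ∘ (degen A n j ∘ x)).
  have dH i : dface B n i ∘ (H n.+1 (step j.+1) ∘ (degen A n j ∘ x)) =
      H n (step j.+1 \o bump i) ∘ (dface A n i ∘ (degen A n j ∘ x)).
    rewrite compmA Hnat; [|exact: nondecreasing_bump|exact: stepP].
    by rewrite -compmA.
  split=> [i ni ij ij'||]; rewrite dH.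
  - by rewrite dface_degen_cycle ?comp_zero.
  - rewrite dface_degen_id_elt ?eqxx //; congr (_ ∘ _); apply: Hext => i _.
    by rewrite /step /= /bump; lia.
  - rewrite dface_degen_id_elt ?eqxx ?orbT //; congr (_ ∘ _); apply: Hext => i _.
    by rewrite /step /= /bump; lia.
have ch j : j <= n.+1 -> homologous hC (c 0) (c j).
  elim: j => [|j IH] jn; first exact: homologous_refl.
  apply: (homologous_trans hP pP (cc j)); first exact: IH (ltnW jn).
  exact: cS.
rewrite (Hext _ _ (step 0)) // [H n (fun _ => 0)](Hext _ _ (step n.+1)); first exact: ch.
by move=> i ni; rewrite /step; lia.
Qed.

(** ** Trivial cofibrations: attaching disks *)

(** Used for [k = n.+1], when it says that [u] is surjective, and for [k = n],
    when it says that [u] is not a simplex of the horn formed by all faces of the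
    standard [n]-simplex but the last one. *)
Definition hits k n m (u : simplex m n) : bool :=
  [forall i : 'I_k, exists j : 'I_m.+1, val u j == i :> nat].

Lemma hitsP k n m (u : simplex m n) : reflect
  (forall i, i < k -> exists2 j, j <= m & simplex_fun u j = i) (hits k u).
Proof.
apply: (iffP idP) => [/forallP h i ik|h].
  have /existsP[j /eqP ji] := h (Ordinal ik).
  by exists j; rewrite -1?ltnS // /simplex_fun inord_val.
apply/forallP => i; apply/existsP; have [j jm ji] := h i (ltn_ord i).
by exists (inord j); rewrite -ji.
Qed.

Lemma hits_comp k n m l (u : simplex m n) (v : simplex l m) :
  hits k (u ∘ v) -> hits k u.
Proof.
move=> /hitsP h; apply/hitsP => i ik; have [j jl ji] := h i ik.
exists (simplex_fun v j); last by rewrite -simplex_fun_comp.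
by have [vm _] := simplex_fun_nondecreasing v; exact: vm.
Qed.

Lemma hits_dim k n m (u : simplex m n) : hits k u -> k <= m.+1.
Proof.
move=> /forallP h; pose f (i : 'I_k) : 'I_m.+1 := xchoose (existsP (h i)).
have fE i : val u (f i) = i :> nat by apply/eqP; exact: (xchooseP (existsP (h i))).
have /leq_card : injective f.
  by move=> i j fij; apply: val_inj; rewrite /= -(fE i) -(fE j) fij.
by rewrite !card_ord.
Qed.

Lemma not_hits_missing k n m (u : simplex m n) : ~~ hits k u ->
  exists2 i, i < k & forall j, j <= m -> simplex_fun u j != i.
Proof.
move=> /forallPn[i /existsPn iu]; exists i => // j jm; exact: (iu (inord j)).
Qed.

Lemma hits_coface n (i : 'I_n.+2) k : hits k (coface i : simplex n n.+1) ->
  k <= i.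
Proof.
move=> /hitsP h; rewrite leqNgt; apply/negP => /h[j jn].
by rewrite /simplex_fun /= ffunE /= /bump; lia.
Qed.

(** A normal simplex is null on the horn described at [hits]. For [n = 0] nothing
    is attached: a constant object is not contractible. *)
Definition disk_free n m (u : simplex m n) : bool := (0 < n) && hits n u.

Lemma disk_free_comp n m k (u : simplex m n) (v : simplex k m) :
  disk_free (u ∘ v) -> disk_free u.
Proof. by case/andP => n0 /hits_comp; rewrite /disk_free n0. Qed.

Lemma disk_free_dim n m (u : simplex m n) : disk_free u -> n <= m.+1.
Proof. by case/andP => _ /hits_dim. Qed.

Lemma disk_not_free_missing n m (u : simplex m n) : 0 < n -> ~~ disk_free u ->
  exists2 i, i < n & forall j, j <= m -> simplex_fun u j != i.
Proof. by move=> n0; rewrite negb_and n0; exact: not_hits_missing. Qed.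

Section DiskExtension.
Variables (X : simplicial C) (P : nat -> C).
Let bd n m (u : simplex m n) : hom (P n) (sob X m) := zero hC _ _.

Lemma disk_extension_exists :
  exists _ : @cell_extension C X P disk_free bd, True.
Proof.
apply: (cell_extension_exists hC).
- exact: disk_free_comp.
- exact: disk_free_dim.
- by move=> *; rewrite /bd comp_zero.
Qed.

Variable Z : @cell_extension C X P disk_free bd.

Lemma ext_gen_disk_normal n : normal hC (ext_gen Z n.+1).
Proof.
move=> i ni; have i2 : i < n.+2 by exact: ltnW.
rewrite /= -(faceE _ (Ordinal i2)) -[face _ _]/(pull Z (coface (Ordinal i2))).
rewrite ext_cell_pull ext_cell_bd ?/bd ?comp_zero // comp1m.
by apply/negP => /andP[_ /hits_coface] /=; lia.
Qed.

Lemma disk_extension_llp : (forall n, projective (P n)) ->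
  forall E B (q : hom E B), normal_surjective hC q -> llp (ext_incl Z) q.
Proof.
move=> pP E B q qn a b qa.
have [|h [hi qh]] := ext_lift qa; last by exists h.
case=> [|n].
  by exists null; split=> [m u _|m u /andP[]//]; rewrite /bd !comp_zero.
have [w [w0 qw]] := qn _ n _ (pP n.+1) (normal_smap b (@ext_gen_disk_normal n)).
exists w; split=> // m u uf; rewrite /bd comp_zero.
have [//|i ni iu] := disk_not_free_missing _ uf.
by apply: (face_null_missing (i := i)) => //; [exact: ltnW | exact: w0].
Qed.

(** Disks are contracted to their last vertex, which is the vertex of the
    horn. *)
Definition contraction n (phi f : nat -> nat) (i : nat) : nat :=
  if phi i == 0 then f i else n.

Lemma contraction_nondecreasing m n phi (u : simplex m n) :
  nondecreasing m 1 phi -> nondecreasing m n (contraction n phi (simplex_fun u)).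
Proof.
move=> [_ pm]; have [un um] := simplex_fun_nondecreasing u.
split=> [i im|i j ij jm]; rewrite /contraction.
  by have := un i im; case: eqP => // _; lia.
have im : i <= m by exact: leq_trans ij jm.
have := pm i j ij jm; have := um i j ij jm; have := un i im.
by case: eqP => pi; case: eqP => pj //; lia.
Qed.

Lemma contraction_free m n phi (u : simplex m n) : nondecreasing m 1 phi ->
  disk_free (simplex_map m n (contraction n phi (simplex_fun u))) -> disk_free u.
Proof.
move=> pP /andP[n0 /hitsP h]; apply/andP; split=> //; apply/hitsP => i ni.
have [j jm] := h i ni; rewrite simplex_funE //; last exact: contraction_nondecreasing.
by rewrite /contraction; case: eqP => _ ji; [exists j | lia].
Qed.

(** The retraction [r] of the inclusion [i] collapses the disks. Fixing [X] and
    contracting the disks is a homotopy from the identity to [i ∘ r]; an operator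
    which is not free is mapped by the contraction to another such operator, so
    that the homotopy is well defined. *)
Lemma disk_extension_homology : homology_bijective hC (ext_incl Z).
Proof.
have [|r [ri rc]] := @ext_hom C X P disk_free bd Z X (idm X) (fun n => null).
  by move=> n m u _; rewrite /bd !comp_zero.
have Hex m phi : exists h : hom (sob Z m) (sob Z m),
    h ∘ smap (ext_incl Z) m = smap (ext_incl Z) m /\
    forall n (u : simplex m n), disk_free u -> h ∘ ext_cell Z u =
      ext_cell Z (simplex_map m n (contraction n phi (simplex_fun u))).
  exact: (ext_map Z).
pose H m phi := projT1 (cid (Hex m phi)).
have Hi m phi : H m phi ∘ smap (ext_incl Z) m = smap (ext_incl Z) m.
  exact: (projT2 (cid (Hex m phi))).1.
have Hc m phi n (u : simplex m n) : nondecreasing m 1 phi ->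
    H m phi ∘ ext_cell Z u =
    ext_cell Z (simplex_map m n (contraction n phi (simplex_fun u))).
  move=> pP; case: (boolP (disk_free u)) => [|uf].
    exact: (projT2 (cid (Hex m phi))).2.
  rewrite !ext_cell_bd ?/bd ?comp_zero //.
  by apply: contra uf; exact: contraction_free.
have Hc' m phi n (u : simplex m n) : disk_free u ->
    H m phi ∘ ext_cell Z u =
    ext_cell Z (simplex_map m n (contraction n phi (simplex_fun u))).
  exact: (projT2 (cid (Hex m phi))).2.
clearbody H.
have Hhom := @homotopy_homologous Z Z H.
have {}Hhom n Q (x : hom Q (sob Z n)) : projective Q -> cycle hC x ->
    homologous hC (smap (ext_incl Z) n ∘ (smap r n ∘ x)) x.
  move=> pQ xc; have H1 : H n (fun _ => 1) = smap (ext_incl Z) n ∘ smap r n.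
    apply: (ext_map_ext (c := Z)) => [|k u uf].
      by rewrite Hi -compmA -[smap r n ∘ _]/(smap (r ∘ ext_incl Z) n) ri compm1.
    rewrite Hc' // -compmA rc !comp_zero ext_cell_bd ?/bd ?comp_zero //.
    have /andP[k0 _] := uf.
    apply/negP => /andP[_ /hitsP /(_ 0 k0)[j jn]].
    have oneP : nondecreasing n 1 (fun _ => 1) by split.
    by rewrite (simplex_funE (contraction_nondecreasing _ oneP)) // /contraction /=; lia.
  have H0 : H n (fun _ => 0) = idm _.
    apply: (ext_map_ext (c := Z)) => [|k u uf]; first by rewrite Hi comp1m.
    rewrite Hc' // comp1m; congr (ext_cell Z _).
    by rewrite -[RHS]simplex_funK.
  have := Hhom _ _ n Q x pQ xc; rewrite H1 H0 comp1m -compmA; apply.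
    move=> m phi psi pp; apply: (ext_map_ext (c := Z)) => [|k u uf].
      by rewrite !Hi.
    rewrite !Hc' //; congr (ext_cell Z _).
    by apply: eq_simplex_map => j jm; rewrite /contraction pp.
  move=> m k g phi gP phiP.
  rewrite -[act Z k m g]/(pull Z (simplex_map k m g)).
  apply: (ext_map_ext (c := Z)) => [|l u _].
    by rewrite -!compmA Hi -pull_smap compmA Hi.
  have pgP : nondecreasing k 1 (phi \o g) by exact: nondecreasing_comp gP phiP.
  rewrite -!compmA Hc // !ext_cell_pull Hc //; congr (ext_cell Z _).
  have cP := contraction_nondecreasing u phiP.
  apply: simplex_hom_ext => i ik; rewrite simplex_fun_comp.
  rewrite (simplex_funE (contraction_nondecreasing _ pgP)) // (simplex_funE gP) //.
  rewrite (simplex_funE cP); last by case: gP => gm _; exact: gm.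
  by rewrite /contraction /= simplex_fun_comp (simplex_funE gP).
move=> Q n pQ; split=> [x x' xc xc' /(homologous_smap r)|y yc].
  by rewrite !compmA -[smap r n ∘ _]/(smap (r ∘ ext_incl Z) n) ri !comp1m.
exists (smap r n ∘ y); split; first exact: cycle_smap.
apply: homologous_sym => //; last exact: Hhom.
by do 2![apply: cycle_smap].
Qed.

End DiskExtension.

Lemma normal_cover_exists Y n : exists (P : C) (w : hom P (sob Y n)),
  [/\ projective P, normal hC w & forall Q (b : hom Q (sob Y n)), projective Q ->
    normal hC b -> exists t, w ∘ t = b].
Proof.
case: n => [|n].
  have [P [p [pP pe]]] := hP (sob Y 0); exists P, p; split=> // Q b pQ _.
  exact: pQ.
have [K [k [km k0 kl]]] :=
  @joint_kernel_exists C hC (sob Y n.+1) _ (dface Y n) n.+1.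
have [P [p [pP pe]]] := hP K; exists P, (k ∘ p); split=> //.
  by move=> i ni /=; rewrite compmA k0 // zero_comp.
move=> Q b pQ b0; have [|h kh] := kl Q b; first by move=> i ni; exact: b0.
by have [t pt] := pQ _ _ p pe h; exists t; rewrite -compmA pt.
Qed.

(** The coefficients of the cells of dimension [n] are a projective object
    covering the object of normal [n]-simplices of [Y], which makes the
    projection to [Y] surjective on normal simplices. *)
Lemma factor_disk_extension X Y (f : hom X Y) :
  exists (Z : simplicial C) (i : hom X Z) (p : hom Z Y),
    [/\ homology_bijective hC i, normal_surjective hC p, f = p ∘ i &
      forall E B (q : hom E B), normal_surjective hC q -> llp i q].
Proof.
pose P n := projT1 (cid (normal_cover_exists Y n)).
pose w n : hom (P n) (sob Y n) := projT1 (cid (projT2 (cid (normal_cover_exists Y n)))).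
have wP n : [/\ projective (P n), normal hC (w n) &
    forall Q (b : hom Q (sob Y n)), projective Q -> normal hC b ->
      exists t, w n ∘ t = b].
  exact: (projT2 (cid (projT2 (cid (normal_cover_exists Y n))))).
clearbody w; clearbody P.
have [Z _] := disk_extension_exists X P.
pose w' n : hom (P n) (sob Y n) := if n is 0 then null else w n.
have [|p [pi pc]] := ext_hom Z (g := f) (w := w').
  move=> n m u uf; rewrite comp_zero; case: n u uf => [|n] u uf.
    by rewrite comp_zero.
  have [//|i ni iu] := disk_not_free_missing _ uf; have [_ wn _] := wP n.+1.
  by apply: (face_null_missing (i := i)) => //; [exact: ltnW | exact: wn].
exists (ext_ob Z), (ext_incl Z), p; split=> //.
- exact: disk_extension_homology.
- move=> Q n b pQ b0; have [_ _ /(_ Q b pQ b0)[t wt]] := wP n.+1.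
  exists (ext_gen Z n.+1 ∘ t); split.
    by move=> i ni; apply: face_null_comp; exact: ext_gen_disk_normal.
  by rewrite compmA pc pull_id comp1m.
- by apply: disk_extension_llp => n; case: (wP n).
Qed.

End Factorizations.

Section SphereCells.
Variables (C : category) (hC : semi_abelian C) (hP : enough_projectives C).
Implicit Types A B X Y : simplicial C.
Local Notation null := (zero hC _ _).

(** ** Cofibrations: attaching cells along their boundary *)

Definition sphere_free d n m (u : simplex m n) : bool := (n == d) && hits n.+1 u.

Lemma sphere_free_comp d n m k (u : simplex m n) (v : simplex k m) :
  sphere_free d (u ∘ v) -> sphere_free d u.
Proof. by case/andP => nd /hits_comp; rewrite /sphere_free nd. Qed.

Lemma sphere_free_dim d n m (u : simplex m n) : sphere_free d u -> n <= m.
Proof. by case/andP => _ /hits_dim. Qed.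

Definition cofibration X Y (i : hom X Y) : Prop :=
  forall E B (q : hom E B), disk_lifting hC q -> llp i q.

Lemma attach_points X (Q : C) : projective Q ->
  exists (Z : simplicial C) (i : hom X Z) (g : hom Q (sob Z 0)),
    cofibration i /\ forall Y (p : hom X Y) (b : hom Q (sob Y 0)),
      exists p' : hom Z Y, p' ∘ i = p /\ smap p' 0 ∘ g = b.
Proof.
move=> pQ.
pose bd n m (u : simplex m n) : hom Q (sob X m) := null.
have [|||Z _] := @cell_extension_exists C hC X (fun _ => Q) (sphere_free 0) bd.
- exact: sphere_free_comp.
- by move=> n m u /sphere_free_dim /leqW.
- by move=> *; rewrite /bd comp_zero.
have free0 n m (u : simplex m n) : ~~ sphere_free 0 u -> n != 0.
  apply: contraNneq => n0; case: _ / (esym n0) u => u; apply/andP; split=> //.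
  apply/hitsP => i i0; exists 0 => //.
  by have [/(_ 0 isT)] := simplex_fun_nondecreasing u; lia.
exists (ext_ob Z), (ext_incl Z), (ext_gen Z 0); split.
  move=> E B q [q0 _] a b qa.
  have [|h [hi qh]] := ext_lift qa; last by exists h.
  move=> n; case: (n =P 0) => [->|/eqP n0].
    have [w qw] := q0 _ (smap b 0 ∘ ext_gen Z 0) pQ; exists w; split=> // m u.
    by move/free0.
  exists null; split=> [m u _|m u /andP[n0' _]]; first by rewrite /bd !comp_zero.
  by rewrite (negbTE n0) in n0'.
move=> Y p b; pose w n : hom Q (sob Y n) := if n is 0 then b else null.
have [|h [hi hc]] := ext_hom Z (g := p) (w := w).
  by case=> [m u /free0 //|n m u _]; rewrite /bd !comp_zero.
by exists h; rewrite hi hc pull_id comp1m.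
Qed.

Section AttachSphere.
Variables (X : simplicial C) (n : nat) (Q : C) (x : hom Q (sob X n)).
Hypothesis xc : cycle hC x.

(** The attaching map: [x] on the last face of the simplex, and null on the other
    faces. *)
Let bd n' m (u : simplex m n') : hom Q (sob X m) :=
  if (n' == n.+1) && hits n.+1 u then act X m n (simplex_fun u) ∘ x else null.

Let last_face m (u : simplex m n.+1) : ~~ hits n.+2 u -> hits n.+1 u ->
  nondecreasing m n (simplex_fun u).
Proof.
move=> /not_hits_missing[i i2 iu] /hitsP h.
have ni : i = n.+1.
  case: (ltngtP i n.+1) i2 => // [i1|]; last by lia.
  by have [j jm ji] := h i i1; have := iu j jm; rewrite ji eqxx.
have [un um] := simplex_fun_nondecreasing u; split=> // j jm.
by have := un j jm; have := iu j jm; lia.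
Qed.

Let sphere_bd_pull n' m k (u : simplex m n') (v : simplex k m) :
  ~~ sphere_free n.+1 u -> bd (u ∘ v) = pull X v ∘ bd u.
Proof.
rewrite /bd /sphere_free; case: (n' =P n.+1) => [n'E|_] /=; last first.
  by rewrite comp_zero.
case: _ / (esym n'E) u => u uf.
case: (boolP (hits n.+1 u)) => hu; last first.
  rewrite comp_zero; case: ifP => // /hits_comp huv.
  by rewrite huv in hu.
have uP := last_face uf hu; have vP := simplex_fun_nondecreasing v.
have <- : act X k n (simplex_fun (u ∘ v)) ∘ x =
    pull X v ∘ (act X m n (simplex_fun u) ∘ x).
  rewrite pull_act compmA act_comp //; congr (_ ∘ _); apply: eq_act => j jk.
  by rewrite simplex_fun_comp.
case: ifPn => // /not_hits_missing[i ni iuv].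
have uvP : nondecreasing k n (simplex_fun (u ∘ v)).
  have [a b] := nondecreasing_comp vP uP.
  split=> [j jk|j l jl lk]; rewrite !simplex_fun_comp; [exact: a | exact: b].
symmetry; rewrite -[act _ _ _ _]/(pull X (simplex_map k n (simplex_fun (u ∘ v)))).
apply: (face_null_missing (i := i)) => //; first exact: xc.
by move=> j jk; rewrite simplex_funE //; exact: iuv.
Qed.

Lemma attach_sphere : projective Q ->
  exists (Z : simplicial C) (i : hom X Z) (g : hom Q (sob Z n.+1)),
    [/\ normal hC g, dface Z n n.+1 ∘ g = smap i n ∘ x,
      forall m, m <= n -> is_iso (smap i m), cofibration i &
      forall Y (p : hom X Y) (b : hom Q (sob Y n.+1)), normal hC b ->
        dface Y n n.+1 ∘ b = smap p n ∘ x ->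
        exists p' : hom Z Y, p' ∘ i = p /\ smap p' n.+1 ∘ g = b].
Proof.
move=> pQ.
have [|||Z _] := @cell_extension_exists C hC X (fun _ => Q) (sphere_free n.+1) bd.
- exact: sphere_free_comp.
- by move=> n' m u /sphere_free_dim /leqW.
- exact: sphere_bd_pull.
pose g : hom Q (sob Z n.+1) := ext_gen Z n.+1.
have coface_not_free (i : 'I_n.+2) :
    ~~ sphere_free n.+1 (coface i : simplex n n.+1).
  by apply/negP => /andP[_ /hits_coface]; have := ltn_ord i; lia.
have g0 : normal hC g.
  move=> i ni; have i2 : i < n.+2 by exact: ltnW.
  rewrite /= -(faceE _ (Ordinal i2)) -[face _ _]/(pull Z (coface (Ordinal i2))).
  rewrite /g ext_cell_pull comp1m ext_cell_bd // /bd eqxx.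
  case: ifP => [/hits_coface /=|_]; [lia | exact: comp_zero].
have gx : dface Z n n.+1 ∘ g = smap (ext_incl Z) n ∘ x.
  rewrite -(faceE _ ord_max) -[face _ _]/(pull Z (coface ord_max)).
  rewrite /g ext_cell_pull comp1m ext_cell_bd // /bd eqxx /=.
  have dE j : j <= n -> simplex_fun (coface ord_max : simplex n n.+1) j = j.
    by move=> jn; rewrite /simplex_fun /= ffunE /= inordK // /bump; lia.
  have -> : hits n.+1 (coface ord_max : simplex n n.+1).
    by apply/hitsP => j jn; exists j => //; rewrite dE.
  by rewrite act_id // comp1m.
have bound (W : simplicial C) (a : hom X W) (b : hom Q (sob W n.+1)) m
    (u : simplex m n.+1) : normal hC b -> dface W n n.+1 ∘ b = smap a n ∘ x ->
    ~~ sphere_free n.+1 u -> pull W u ∘ b = smap a m ∘ bd u.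
  rewrite /sphere_free eqxx /= => b0 bx uf; rewrite /bd eqxx /=.
  case: (boolP (hits n.+1 u)) => hu; last first.
    have [i ni iu] := not_hits_missing hu; rewrite comp_zero.
    by apply: (face_null_missing (i := i)) => //; [exact: ltnW | exact: b0].
  have uP := last_face uf hu.
  rewrite compmA act_smap -compmA -bx pull_act compmA act_comp //.
    congr (_ ∘ _); apply: eq_act => j jm.
    by case: uP => /(_ j jm) /=; rewrite /bump; lia.
  exact: nondecreasing_bump.
exists (ext_ob Z), (ext_incl Z), g; split=> //.
- move=> m mn; apply: (ext_incl_iso hC) => n' u; apply/negP => uf.
  by have := sphere_free_dim uf; case/andP: uf => /eqP; lia.
- move=> E B q [_ qS] a b qa.
  have [|h [hi qh]] := ext_lift qa; last by exists h.
  move=> n'; case: (n' =P n.+1) => [->|/eqP nn'].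
    have [|w [w0 wx qw]] := qS _ _ (smap a n ∘ x) (smap b n.+1 ∘ g) pQ
      (cycle_smap a xc) (normal_smap b g0).
      rewrite dface_smap_elt gx !compmA -[smap q n ∘ _]/(smap (q ∘ a) n).
      by rewrite qa.
    by exists w; split=> // m u; exact: bound.
  exists null; rewrite /bd (negbTE nn') /=; split=> [m u _|m u].
    by rewrite !comp_zero.
  by rewrite /sphere_free (negbTE nn').
- move=> Y p b b0 bx.
  pose w n' : hom Q (sob Y n') := match n' =P n.+1 with
    | ReflectT e => match esym e in _ = n' return hom Q (sob Y n') with
                    | erefl => b end
    | ReflectF _ => null end.
  have wn : w n.+1 = b.
    rewrite /w; case: eqP => // e; by rewrite (Prop_irrelevance e erefl).
  have [|h [hi hc]] := ext_hom Z (g := p) (w := w).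
    move=> n' m u; case: (n' =P n.+1) => [n'E|/eqP nn'].
      by case: _ / (esym n'E) u => u; rewrite wn; exact: bound.
    rewrite /bd (negbTE nn') comp_zero /w; case: eqP => [e|_ _].
      by rewrite e eqxx in nn'.
    exact: comp_zero.
  by exists h; rewrite hi hc pull_id comp1m wn.
Qed.

End AttachSphere.

(** [Q] covers the object of all lifting problems for [p] against the inclusion
    of a sphere into a disk, for which [x] and [b] are the universal data. *)
Lemma cycle_filler_cover A Y (p : hom A Y) n :
  exists (Q : C) (x : hom Q (sob A n)) (b : hom Q (sob Y n.+1)),
    [/\ projective Q, cycle hC x, normal hC b, dface Y n n.+1 ∘ b = smap p n ∘ x &
    forall T (x' : hom T (sob A n)) (b' : hom T (sob Y n.+1)), projective T ->
      cycle hC x' -> normal hC b' -> dface Y n n.+1 ∘ b' = smap p n ∘ x' ->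
      exists t, x ∘ t = x' /\ b ∘ t = b'].
Proof.
have [N _] := moore_complex_exists hC A; have [M _] := moore_complex_exists hC Y.
have [Zc [z zP]] := cycles_exists hC N n.
have cc := cycles_cycle hC zP; have cl := @cycles_lift C hC A N n Zc z zP.
set c := moore_incl N n ∘ z in cc cl.
have t0 := @moore_incl_normal C hC Y M n.+1; have tl := @moore_lift C hC Y M n.+1.
set t := moore_incl M n.+1 in t0 tl; clearbody c t.
have [R [u [v [uv Rl]]]] := pullback (regular_limits (exact_regular
  (semi_abelian_exact hC))) (smap p n ∘ c) (dface Y n n.+1 ∘ t).
have [Q [e [pQ ee]]] := hP R.
exists Q, (c ∘ u ∘ e), (t ∘ v ∘ e); split=> //.
- by do 2![apply: cycle_comp].
- by move=> i ni; do 2![apply: face_null_comp]; exact: t0.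
- by rewrite !compmA -uv.
move=> T x' b' pT x'c b'0 b'x.
have [x1 cx] := cl _ _ x'c; have [b1 tb] := tl _ _ b'0.
have [|h [[hu hv] _]] := Rl T x1 b1; first by rewrite -!compmA cx tb.
have [s es] := pT _ _ e ee h; exists s.
by rewrite -!compmA es hu hv.
Qed.

Lemma cofibration_comp X Y Z (i : hom X Y) (j : hom Y Z) :
  cofibration i -> cofibration j -> cofibration (j ∘ i).
Proof.
move=> ic jc E B q qd a b qa.
have [|h [hi qh]] := ic _ _ q qd a (b ∘ j); first by rewrite -compmA.
have [k [kj qk]] := jc _ _ q qd h b qh.
by exists k; rewrite compmA kj.
Qed.

Lemma cofibration_chain (Z : nat -> simplicial C) (i : forall k, hom (Z k) (Z k.+1))
    (L : simplicial C) (j : forall k, hom (Z k) L) :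
  (forall k, cofibration (i k)) -> @graph_colimit nat nat id S _ Z i L j ->
  cofibration (j 0).
Proof.
move=> ic [jc ju] E B q qd a b qa.
pose T k := {t : hom (Z k) E | q ∘ t = b ∘ j k}.
have next k (t : T k) : exists t' : T k.+1, projT1 t' ∘ i k = projT1 t.
  have [|h [hi qh]] := ic k _ _ q qd (projT1 t) (b ∘ j k.+1).
    by rewrite (projT2 t) -(jc k) compmA.
  by exists (exist _ h qh).
pose t := nat_rect T (exist _ a qa) (fun k tk => projT1 (cid (next k tk))).
have [|h [hj _]] := ju E (fun k => projT1 (t k)).
  by move=> k; exact: (projT2 (cid (next k (t k)))).
exists h; split; first exact: (hj 0).
have [|k [_ ku]] := ju B (fun k => b ∘ j k); first by move=> k; rewrite -compmA jc.
rewrite -(ku b) // -(ku (q ∘ h)) // => l.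
by rewrite -compmA hj (projT2 (t l)).
Qed.

(** One step of the construction by which a projective resolution is made: all
    the liftings required in dimension [n] are supplied by cells of dimension
    [n.+1], and the degrees up to [n] do not change. *)
Lemma factor_step Y n Z (p : hom Z Y) :
  exists (Z' : simplicial C) (i : hom Z Z') (p' : hom Z' Y),
    [/\ p' ∘ i = p, forall m, m <= n -> is_iso (smap i m), cofibration i &
    forall T (x : hom T (sob Z n)) (b : hom T (sob Y n.+1)), projective T ->
      cycle hC x -> normal hC b -> dface Y n n.+1 ∘ b = smap p n ∘ x ->
      exists a : hom T (sob Z' n.+1), [/\ normal hC a,
        dface Z' n n.+1 ∘ a = smap i n ∘ x & smap p' n.+1 ∘ a = b]].
Proof.
have [Q [x [b [pQ xc b0 bx xbl]]]] := cycle_filler_cover p n.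
have [Z' [i [g [g0 gx ii ic ih]]]] := attach_sphere xc pQ.
have [p' [p'i p'g]] := ih Y p b b0 bx.
exists Z', i, p'; split=> // T x' b' pT x'c b'0 b'x.
have [t [xt bt]] := xbl T x' b' pT x'c b'0 b'x.
exists (g ∘ t); rewrite !compmA gx p'g -!compmA xt bt; split=> //.
by move=> l nl; apply: face_null_comp; exact: g0.
Qed.

(** All liftings in degree 0 are supplied first, then those in the dimensions
    1, 2, ... by [factor_step]. A lifting problem for the colimit in dimension [n]
    lives in degrees which are already final at stage [n]. *)
Lemma factor_cofibration X Y (f : hom X Y) :
  exists (E : simplicial C) (i : hom X E) (p : hom E Y),
    [/\ cofibration i, disk_lifting hC p & f = p ∘ i].
Proof.
have [Q [y0 [pQ y0e]]] := hP (sob Y 0).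
have [Z0 [i0 [g [i0c i0h]]]] := attach_points X pQ.
have [p0 [p0i p0g]] := i0h Y f y0.
pose state := {Z : simplicial C & hom Z Y}.
have step (n : nat) (s : state) := factor_step n (projT2 s).
pose next n (s : state) : state := let Z' := cid (step n s) in
  existT _ (projT1 Z') (projT1 (cid (projT2 (cid (projT2 Z'))))).
pose chain := nat_rect (fun _ => state) (existT _ Z0 p0) next.
pose Z k := projT1 (chain k); pose p k : hom (Z k) Y := projT2 (chain k).
pose i k : hom (Z k) (Z k.+1) := projT1 (cid (projT2 (cid (step k (chain k))))).
have iP k : [/\ p k.+1 ∘ i k = p k, forall m, m <= k -> is_iso (smap (i k) m),
    cofibration (i k) &
    forall T (x : hom T (sob (Z k) k)) (b : hom T (sob Y k.+1)), projective T ->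
      cycle hC x -> normal hC b -> dface Y k k.+1 ∘ b = smap (p k) k ∘ x ->
      exists a : hom T (sob (Z k.+1) k.+1), [/\ normal hC a,
        dface (Z k.+1) k k.+1 ∘ a = smap (i k) k ∘ x & smap (p k.+1) k.+1 ∘ a = b]].
  exact: (projT2 (cid (projT2 (cid (projT2 (cid (step k (chain k)))))))).
have Zi : Z 0 = Z0 by [].
pose h0 : hom X (Z 0) := i0; pose g0 : hom Q (sob (Z 0) 0) := g.
have h0c : cofibration h0 by exact: i0c.
have ph0 : p 0 ∘ h0 = f by exact: p0i.
have pg0 : smap (p 0) 0 ∘ g0 = y0 by exact: p0g.
clearbody h0 g0; clear Zi; clearbody i; clearbody p; clearbody Z.
have [|L [j [jL ji]]] := @simplicial_chain_colimit C Z i.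
  by move=> k m; have [_ ii _ _] := iP k; exact: ii.
have [jc ju] := jL; have [|q [qj _]] := ju Y p.
  by move=> k; have [pi _ _ _] := iP k.
exists L, (j 0 ∘ h0), q; split; last by rewrite compmA qj.
  apply: cofibration_comp => //; apply: (cofibration_chain _ jL) => k.
  by have [_ _ ic _] := iP k.
split=> [T b pT|T n x b pT xc b0 bx].
  have [t yt] := pT _ _ _ y0e b; exists (smap (j 0) 0 ∘ (g0 ∘ t)).
  by rewrite compmA -[smap q 0 ∘ _]/(smap (q ∘ j 0) 0) qj compmA pg0.
have [x' jx'] : exists x', smap (j n) n ∘ x' = x.
  have [l [_ ll]] := ji n n (leqnn n); exists (l ∘ x).
  by rewrite compmA ll comp1m.
have x'c : cycle hC x'.
  move: xc; rewrite -jx'; clear -ji; case: n x' => // n x' xc l nl.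
  apply: (is_iso_mono (ji n.+1 n (leqW (leqnn n)))).
  by rewrite -dface_smap_elt (xc l nl) comp_zero.
have [_ _ _ iN] := iP n.
have [|a [a0 ax qa]] := iN T x' b pT x'c b0.
  by rewrite bx -jx' compmA -[smap q n ∘ _]/(smap (q ∘ j n) n) qj.
exists (smap (j n.+1) n.+1 ∘ a); split; first exact: normal_smap.
  rewrite dface_smap_elt ax compmA -[smap _ n ∘ smap _ n]/(smap (j n.+1 ∘ i n) n).
  by rewrite (jc n).
by rewrite compmA -[smap q _ ∘ _]/(smap (q ∘ j n.+1) n.+1) qj.
Qed.

(** * The model structure *)

Lemma cofibration_retract : retract_closed (@cofibration).
Proof.
move=> X Y X' Y' i j [s [r [s' [r' [rs rs' js ir]]]]] jc E B q qd a b qa.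
have [|l [lj ql]] := jc _ _ q qd (a ∘ r) (b ∘ r').
  by rewrite compmA qa -!compmA ir.
exists (l ∘ s'); split; first by rewrite -compmA -js compmA lj -compmA rs compm1.
by rewrite compmA ql -compmA rs' compm1.
Qed.

(** The retract argument: a trivial cofibration is a retract of the disk extension
    through which it factors. *)
Lemma trivial_cofibration_lift A B X Y (i : hom A B) (p : hom X Y) :
  cofibration i -> homology_bijective hC i -> normal_surjective hC p -> llp i p.
Proof.
move=> ic ib pn a b pa.
have [Z [j [q [jb qn iE jl]]]] := factor_disk_extension hC hP i.
have qb : homology_bijective hC q.
  by apply: (homology_bijective_cancelr hP jb); rewrite -iE.
have [|s [si qs]] := ic _ _ q (fibration_disk_lifting hP qn qb) j (idm B).
  by rewrite comp1m.
have [|l [lj pl]] := jl _ _ p pn a (b ∘ q); first by rewrite -compmA -iE.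
exists (l ∘ s); split; first by rewrite -compmA si.
by rewrite compmA pl -compmA qs compm1.
Qed.

End SphereCells.

Theorem theorem5p6 (C : category) (hC : semi_abelian C)
    (hP : enough_projectives C) :
  exists M : model_structure (simplicial C),
    (forall (A B : simplicial C) (f : hom A B), weq M f <-> homology_iso f) /\
    (forall (A B : simplicial C) (f : hom A B), fib M f <-> kan_fibration f).
Proof.
unshelve eexists (@ModelStructure (simplicial C) (@homology_bijective C hC)
  (@normal_surjective C hC) (@cofibration C hC) _ _ _ _ _ _ _ _ _ _ _ _).
- apply: simplicial_finite_limits.
  exact: regular_limits (exact_regular (semi_abelian_exact hC)).
- exact: simplicial_finite_colimits (finite_colimits hC hP).
- exact: homology_bijective_comp.
- exact: homology_bijective_cancell.
- exact: homology_bijective_cancelr.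
- exact: homology_bijective_retract.
- exact: normal_surjective_retract.
- exact: cofibration_retract.
- move=> A B i; split=> ic X Y p; last first.
    move=> pd; apply: ic.
      exact: disk_lifting_normal_surjective.
    exact: disk_lifting_homology.
  by move=> pn pb; apply: ic; exact: fibration_disk_lifting.
- by move=> A B X Y i p; exact: trivial_cofibration_lift.
- move=> X Y f; have [E [i [p [ic pd fE]]]] := factor_cofibration hC hP f.
  exists E, i, p; split=> //; first exact: disk_lifting_normal_surjective.
  exact: disk_lifting_homology.
- move=> X Y f; have [Z [i [p [ib pn fE il]]]] := factor_disk_extension hC hP f.
  exists Z, i, p; split=> // E B q qd; apply: il.
  exact: disk_lifting_normal_surjective.
- split=> A B f; first by symmetry; exact: homology_isoE.
  by symmetry; exact: kan_fibrationE.
Qed.
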